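(* Let $\mathbf{X}=[\mathbf{x}_1,\ldots,\mathbf{x}_n]\in\mathbb{R}^{d\times n}$ have nonzero columns, let $m$ be an integer with $2\le m<d$, let $0<\alpha<1$, let $\mathbf{C}=\frac1n\mathbf{X}\mathbf{X}^T$, and let $\mathbf{C}_e$ be the DACE estimator described in the context, built with the sampling probabilities $p_{ki}=\alpha\frac{|x_{ki}|}{\|\mathbf{x}_i\|_1}+(1-\alpha)\frac{x_{ki}^2}{\|\mathbf{x}_i\|_2^2}$ for all $k\in[d]$, $i\in[n]$. Then for any $\eta,\delta\in(0,1)$, with probability at least $1-\eta-\delta$, $$\|\mathbf{C}_e-\mathbf{C}\|_2\le \log\Big(\frac{2d}{\delta}\Big)\frac{2R}{3}+\sqrt{2\sigma^2\log\Big(\frac{2d}{\delta}\Big)},$$ where $$R=\max_{i\in[n]}\left[\frac{7\|\mathbf{x}_i\|_2^2}{n}+\log^2\Big(\frac{2nd}{\eta}\Big)\frac{14\|\mathbf{x}_i\|_1^2}{nm\alpha^2}\right],$$ $$\sigma^2=\sum_{i=1}^n\left[\frac{8\|\mathbf{x}_i\|_2^4}{n^2m^2(1-\alpha)^2}+\frac{4\|\mathbf{x}_i\|_1^2\|\mathbf{x}_i\|_2^2}{n^2m^3\alpha^2(1-\alpha)}+\frac{9\|\mathbf{x}_i\|_2^4}{n^2m(1-\alpha)}+\frac{2\|\mathbf{x}_i\|_2^2\|\mathbf{x}_i\|_1^2}{n^2m^2\alpha(1-\alpha)}\right]+\Big\|\sum_{i=1}^n\frac{\|\mathbf{x}_i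\|_1^2\,\mathbf{x}_i\mathbf{x}_i^T}{n^2m\alpha}\Big\|_2.$$
   Context: DACE construction. Given $\mathbf{X}=[\mathbf{x}_1,\ldots,\mathbf{x}_n]\in\mathbb{R}^{d\times n}$ with $\mathbf{x}_i=(x_{1i},\ldots,x_{di})^T$, an integer $m$ with $2\le m<d$ and $\alpha\in(0,1)$, set $p_{ki}=\alpha\frac{|x_{ki}|}{\|\mathbf{x}_i\|_1}+(1-\alpha)\frac{x_{ki}^2}{\|\mathbf{x}_i\|_2^2}$ for $k\in[d]$, $i\in[n]$. For every $i$ and $j\in[m]$, draw indices $t_{ji}\in[d]$ independently (over all $i,j$) with $\mathbb{P}(t_{ji}=k)=p_{ki}$. With $\mathbf{e}_1,\ldots,\mathbf{e}_d$ the standard basis of $\mathbb{R}^d$, let $\mathbf{S}_i\in\mathbb{R}^{d\times m}$ have $j$-th column $\mathbf{e}_{t_{ji}}/\sqrt{m\,p_{t_{ji}i}}$. For a square matrix $\mathbf{A}$, $\mathbb{D}(\mathbf{A})$ is the diagonal matrix with the main diagonal of $\mathbf{A}$; for a vector $\mathbf{b}$, $\mathbb{D}(\mathbf{b})$ is the diagonal matrix with $\mathbf{b}$ on its diagonal. Let $b_{ki}=\frac{1}{1+(m-1)p_{ki}}$, $\mathbf{b}_i=(b_{1i},\ldots,b_{di})^T$, $\widehat{\mathbf{C}}_1=\frac{m}{nm-n}\sum_{i=1}^n\mathbf{S}_i\mathbf{S}_i^T\mathbf{x}_i\mathbf{x}_i^T\mathbf{S}_i\mathbf{S}_i^T$,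 $\widehat{\mathbf{C}}_2=\frac{m}{nm-n}\sum_{i=1}^n\mathbb{D}(\mathbf{S}_i\mathbf{S}_i^T\mathbf{x}_i\mathbf{x}_i^T\mathbf{S}_i\mathbf{S}_i^T)\mathbb{D}(\mathbf{b}_i)$, and $\mathbf{C}_e=\widehat{\mathbf{C}}_1-\widehat{\mathbf{C}}_2$. $\|\cdot\|_2$ of a matrix is the spectral norm. *)

(* Defs.v *)
From HB Require Import structures.
From mathcomp Require Import all_boot all_order all_algebra.
From mathcomp Require Import classical_sets reals exp.
Set Implicit Arguments. Unset Strict Implicit. Unset Printing Implicit Defensive.
Import Order.TTheory GRing.Theory Num.Theory.
Local Open Scope ring_scope.

Section DACE.
Variable R : realType.

Definition vnorm q (v : 'cV[R]_q) : R := Num.sqrt (\sum_(k < q) v k 0 ^+ 2).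

Definition specnorm p q (A : 'M[R]_(p, q)) : R :=
  reals.sup [set r : R | exists v : 'cV[R]_q, vnorm v = 1 /\ r = vnorm (A *m v)]%classic.

Definition Ddiag d (A : 'M[R]_d) : 'M[R]_d :=
  \matrix_(k, l) (if k == l then A k k else 0).
Definition Dvec d (b : 'I_d -> R) : 'M[R]_d :=
  \matrix_(k, l) (if k == l then b k else 0).

Variables (d n m : nat) (X : 'M[R]_(d, n)) (alpha : R).

Definition l1n (i : 'I_n) : R := \sum_(k < d) `|X k i|.
Definition l2sq (i : 'I_n) : R := \sum_(k < d) X k i ^+ 2.

Definition pki (k : 'I_d) (i : 'I_n) : R :=
  alpha * `|X k i| / l1n i + (1 - alpha) * X k i ^+ 2 / l2sq i.

Definition bki (k : 'I_d) (i : 'I_n) : R := (1 + (m%:R - 1) * pki k i)^-1.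

(* sample outcome: t (i, j) = t_{ji} *)
Definition outcome := {ffun 'I_n * 'I_m -> 'I_d}.

(* probability mass of an outcome (independent draws) *)
Definition weight (t : outcome) : R := \prod_(ij : 'I_n * 'I_m) pki (t ij) ij.1.

Definition Smat (t : outcome) (i : 'I_n) : 'M[R]_(d, m) :=
  \matrix_(k, j) (if t (i, j) == k then (Num.sqrt (m%:R * pki k i))^-1 else 0).

Definition SxxS (t : outcome) (i : 'I_n) : 'M[R]_d :=
  Smat t i *m (Smat t i)^T *m col i X *m (col i X)^T *m Smat t i *m (Smat t i)^T.

Definition Cfac : R := m%:R / (n%:R * m%:R - n%:R).

Definition C1hat (t : outcome) : 'M[R]_d := Cfac *: \sum_(i < n) SxxS t i.
Definition C2hat (t : outcome) : 'M[R]_d :=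
  Cfac *: \sum_(i < n) (Ddiag (SxxS t i) *m Dvec (fun k => bki k i)).
Definition Ce (t : outcome) : 'M[R]_d := C1hat t - C2hat t.

Definition Cmat : 'M[R]_d := n%:R^-1 *: (X *m X^T).

Definition Rbound (eta : R) : R :=
  \big[Num.max/0]_(i < n)
    (7 * l2sq i / n%:R
     + (ln (2 * n%:R * d%:R / eta)) ^+ 2 * (14 * l1n i ^+ 2)
         / (n%:R * m%:R * alpha ^+ 2)).

Definition sigma2 : R :=
  \sum_(i < n)
    (8 * l2sq i ^+ 2 / (n%:R ^+ 2 * m%:R ^+ 2 * (1 - alpha) ^+ 2)
     + 4 * l1n i ^+ 2 * l2sq i / (n%:R ^+ 2 * m%:R ^+ 3 * alpha ^+ 2 * (1 - alpha))
     + 9 * l2sq i ^+ 2 / (n%:R ^+ 2 * m%:R * (1 - alpha))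
     + 2 * l2sq i * l1n i ^+ 2 / (n%:R ^+ 2 * m%:R ^+ 2 * alpha * (1 - alpha)))
  + specnorm (\sum_(i < n)
       ((l1n i ^+ 2 / (n%:R ^+ 2 * m%:R * alpha)) *: (col i X *m (col i X)^T))).

End DACE.

(* Main.v *)
(* Matrix concentration with the truncation built in. Each column contributes an
   independent summand Z_i (its contribution to C_e - C), which is centered, satisfies
   E Z_i^2 <= V_i with ||sum_i V_i|| <= sigma^2, and on an event of probability at
   least 1 - eta has norm at most r = 2R/3.

   For symmetric H, Z with ||Z|| <= r < 2,
     tr e^(H+Z) <= tr e^H + tr(Z e^H) + (1 - r/2)^-1 / 2 * tr(Z^2 e^H).
   This follows by walking from H to H + Z in small steps: between the eigenbases of
   two matrices the entries of a difference of exponentials are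
   (e^b - e^a) / (b - a) times those of the difference of the matrices, and this
   divided difference is at most (e^a + e^b) / 2. Neither Golden-Thompson nor Lieb's
   theorem is needed. Averaging over Z_i, and using
   tr e^H + tr(g V_i e^H) <= tr e^(H + g V_i), one replaces the summands Z_i one at a
   time by g V_i; the Chernoff bound gives Bernstein's inequality. The slack between
   r and R pays for the factor (1 - r/2)^-1 in place of the usual exponential.

   The variance is computed exactly from the factorial moments of the multinomial
   counts, and the norm bound comes from a Chernoff bound for each count. *)
Require Import Defs.
From HB Require Import structures.
From mathcomp Require Import all_boot all_order all_algebra.
From mathcomp Require Import complex.
From mathcomp Require spectral sesquilinear.
From mathcomp Require Import boolp classical_sets functions reals.
From mathcomp Require Import sequences topology normedtype derive realfun exp.
From mathcomp Require Import ring lra.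
Set Implicit Arguments. Unset Strict Implicit. Unset Printing Implicit Defensive.
Import Order.TTheory GRing.Theory Num.Theory.
Import numFieldNormedType.Exports.
Local Open Scope ring_scope.

(** * The spectral theorem over a real closed field *)

(** The choice [r = 2R/3] reproduces Bernstein's classical constant. For summands of norm at most R
    the scalar argument has the denominator [1 - theta * R / 3]; the trapezoid argument has
    [1 - theta * r / 2], which is the same number. The weight of the squared 2-norm shows that R has
    room for this: the norm estimate produces 41/9, and two thirds of the 7 in R is 42/9. The
    obstacle to truncating is that a summand is centered only over the whole space, while its norm
    is controlled only on an event. The indicator of the event is therefore put on the trace
    exponential alone, and the mean and the variance are always those of the untruncated summand. A
    sampling probability may be zero. The moment computations therefore never divide by it: they use
    a vector v with [q k * v k = x k], and every q is absorbed through this relation. All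
    expectations are finite sums over outcomes, and independence is expressed by redrawing a block
    of coordinates from a second outcome. Truncation costs eta/2 and each of the two one-sided tails
    delta/2, so half of eta is never spent. *)

Section RealSpectral.
Variable R : rcfType.

(** Over the complex numbers A is Hermitian, so its spectral diagonal is real. Such an entry is a
    root of the characteristic polynomial, whose coefficients are real; hence it is already an
    eigenvalue over R and has a real eigenvector. *)
Lemma sym_eigenvector n (A : 'M[R]_n.+1) : A^T = A ->
  exists a (v : 'rV[R]_n.+1), v != 0 /\ v *m A = a *: v.
Proof.
move=> Asym.
pose i2C : {rmorphism R -> complex.complex R} := complex.real_complex R.
pose AC := map_mx i2C A.
have Areal x : i2C x \is Num.real.
  by apply/complex.complex_realP; exists x.
have ACherm : AC \is sesquilinear.hermsymmx.
  apply: spectral.realsym_hermsym.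
    apply/sesquilinear.is_hermitianmxP.
    by rewrite expr0 scale1r map_mx_id //; apply/matrixP => i j; rewrite !mxE -[in LHS]Asym mxE.
  by apply/mxOverP => i j; rewrite mxE Areal.
have spreal := spectral.hermitian_spectral_diag_real ACherm.
have /spectral.hermitian_normalmx/spectral.orthomx_spectralP := ACherm.
set P := spectral.spectralmx AC; set sp := spectral.spectral_diag AC => AE.
have Punit : P \in unitmx by exact: spectral.spectral_unit.
have /mxOverP/(_ 0 0) := spreal; rewrite -/sp => /complex.RRe_real.
set a := complex.Re _ => aE.
have eigC : eigenvalue AC (i2C a).
  apply/eigenvalueP; exists (row 0 P); last first.
    apply/negP => /eqP r0.
    have : row 0 P *m invmx P = 0 by rewrite r0 mul0mx.
    rewrite -row_mul mulmxV // => /matrixP/(_ 0 0); rewrite !mxE eqxx => /eqP.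
    by rewrite oner_eq0.
  rewrite -row_mul [in LHS]AE -mulmxA mulKVmx // row_mul row_diag_mx.
  by rewrite -scalemxAl -rowE -aE.
move: eigC; rewrite eigenvalue_root_char /AC -map_char_poly fmorph_root.
rewrite -eigenvalue_root_char => /eigenvalueP [v vA v0].
by exists a, v.
Qed.

Lemma dot_self_ge0 n (v : 'rV[R]_n) : 0 <= (v *m v^T) 0 0.
Proof. by rewrite mxE sumr_ge0 // => i _; rewrite mxE -expr2 sqr_ge0. Qed.

Lemma dot_self_eq0 n (v : 'rV[R]_n) : ((v *m v^T) 0 0 == 0) = (v == 0).
Proof.
apply/eqP/eqP => [|->]; last by rewrite mul0mx mxE.
rewrite mxE => /psumr_eq0P H; apply/rowP => i.
have /H/(_ i isT) : forall k, true -> 0 <= v 0 k * v^T k 0.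
  by move=> k _; rewrite mxE -expr2 sqr_ge0.
by rewrite !mxE => /eqP; rewrite mulf_eq0 orbb => /eqP.
Qed.

(* A Householder reflection. *)
Lemma orthogonal_row0 n (v : 'rV[R]_n.+1) : v *m v^T = 1%:M ->
  exists P : 'M[R]_n.+1, P *m P^T = 1%:M /\ row 0 P = v.
Proof.
move=> v1; pose e : 'rV[R]_n.+1 := delta_mx 0 0.
have e1 : e *m e^T = 1%:M.
  rewrite trmx_delta mul_delta_mx; apply/matrixP => i j.
  by rewrite !ord1 !mxE.
have [->|ve] := eqVneq v e.
  by exists 1%:M; rewrite trmx1 mulmx1 rowE mulmx1.
have [w wE] : exists w, w = e - v by exists (e - v).
pose s := (w *m w^T) 0 0.
have w0 : w != 0 by rewrite wE subr_eq0 eq_sym.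
have s0 : s != 0 by rewrite /s dot_self_eq0.
have sE : w *m w^T = s%:M by rewrite [LHS]mx11_scalar.
pose P : 'M[R]_n.+1 := 1%:M - (2 / s) *: (w^T *m w).
have PT : P^T = P.
  by rewrite /P linearB /= trmx1 linearZ /= trmx_mul trmxK.
exists P; split.
  rewrite PT /P mulmxBl mul1mx mulmxBr mulmx1 -!scalemxAl -!scalemxAr.
  rewrite mulmxA -(mulmxA w^T w) sE mul_mx_scalar -scalemxAl !scalerA.
  rewrite -addrA -opprD -scalerBl -scalerDl.
  have -> : 2 / s + (2 / s - 2 / s * (2 / s * s)) = 0.
    by field.
  by rewrite scale0r subr0.
rewrite rowE -/e /P mulmxBr mulmx1 -scalemxAr mulmxA.
have ev : e *m v^T = v *m e^T.
  by apply: trmx_inj; rewrite trmx_mul trmxK [RHS]mx11_scalar [LHS]mx11_scalar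
     trmx_mul trmxK; congr (_%:M); rewrite !mxE; apply: eq_bigr => i _; rewrite !mxE mulrC.
have -> : e *m w^T = (s / 2)%:M.
  apply: (scalerI (_ : 2 != 0)); first by rewrite pnatr_eq0.
  rewrite scale_scalar_mx mulrC divfK ?pnatr_eq0 // -sE wE linearB /=.
  by rewrite !mulmxBr !mulmxBl e1 v1 -ev scaler_nat mulr2n opprB.
rewrite mul_scalar_mx scalerA.
have -> : 2 / s * (s / 2) = 1 by field.
by rewrite scale1r wE opprB addrC subrK.
Qed.

(** Deflation: in an orthonormal basis that starts with a unit eigenvector, the first row of A is a
    multiple of the first basis vector, and by symmetry so is the first column. Induction applies to
    the remaining block. *)
Theorem sym_spectral n (A : 'M[R]_n) : A^T = A ->
  exists (U : 'M[R]_n) (a : 'rV[R]_n),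
    U *m U^T = 1%:M /\ A = U^T *m diag_mx a *m U.
Proof.
elim: n => [|n IHn] in A *.
  by move=> _; exists 1%:M, 0; split; apply/matrixP => -[].
move=> Asym; have [a [v [v0 vA]]] := sym_eigenvector Asym.
pose s := (v *m v^T) 0 0.
have s0 : 0 < s by rewrite lt_neqAle dot_self_ge0 andbT eq_sym dot_self_eq0.
pose u := (Num.sqrt s)^-1 *: v.
have u1 : u *m u^T = 1%:M.
  rewrite /u linearZ /= -scalemxAl -scalemxAr scalerA -expr2 exprVn.
  rewrite sqr_sqrtr ?ltW // [v *m _]mx11_scalar -/s scale_scalar_mx mulVf //.
  by rewrite gt_eqF.
have uA : u *m A = a *: u by rewrite /u -scalemxAl vA !scalerA mulrC.
have [P [PP Pu]] := orthogonal_row0 u1.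
pose B : 'M[R]_(1 + n) := P *m A *m P^T.
have Bsym : B^T = B by rewrite /B !trmx_mul trmxK Asym mulmxA.
have B0 : row 0 B = a *: delta_mx 0 0.
  rewrite /B !row_mul Pu uA -scalemxAl -Pu -row_mul PP.
  by rewrite rowE mulmx1.
have Bur : ursubmx B = 0.
  apply/matrixP => i j; rewrite !mxE ord1.
  move/rowP: B0 => /(_ (rshift 1 j)); rewrite !mxE.
  have -> : lshift n (0 : 'I_1) = 0 by apply: val_inj.
  by move=> ->; rewrite mulr0.
have Bdl : dlsubmx B = 0.
  by apply: trmx_inj; rewrite trmx_dlsub Bsym Bur trmx0.
have Bul : ulsubmx B = a%:M.
  apply/matrixP => i j; rewrite !mxE !ord1.
  move/rowP: B0 => /(_ (lshift n 0)); rewrite !mxE.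
  have -> : lshift n (0 : 'I_1) = 0 by apply: val_inj.
  by move=> ->; rewrite mulr1.
have drsym : (drsubmx B)^T = drsubmx B by rewrite trmx_drsub Bsym.
have [U [b [UU Bdr]]] := IHn _ drsym.
pose V : 'M[R]_(1 + n) := block_mx 1%:M 0 0 U.
have VV : V *m V^T = 1%:M.
  rewrite /V tr_block_mx mulmx_block !trmx0 trmx1 !mulmx0 !mul0mx !mulmx1.
  by rewrite UU !addr0 !add0r -scalar_mx_block.
have BE : B = V^T *m diag_mx (row_mx a%:M b) *m V.
  rewrite -[LHS]submxK Bur Bdl Bul Bdr /V tr_block_mx diag_mx_row !mulmx_block.
  rewrite !trmx0 trmx1 !mulmx0 !mul0mx !mulmx1 !mul1mx !addr0 !add0r mul0mx.
  congr (block_mx _ _ _ _).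
  by apply/matrixP => i j; rewrite !mxE !ord1 /= mulr1n.
exists (V *m P), (row_mx a%:M b); split.
  by rewrite trmx_mul mulmxA -(mulmxA V) PP mulmx1.
rewrite trmx_mul !mulmxA -(mulmxA P^T V^T) -(mulmxA P^T) -BE /B.
have PP' : P^T *m P = 1%:M by apply: mulmx1C.
by rewrite !mulmxA PP' mul1mx -mulmxA PP' mulmx1.
Qed.

End RealSpectral.

(** * The trace exponential *)

(** Twice the gap is [f x + 2], where [f 0 = -2] and the derivative of f is nonnegative because
    [(1 - c) * expR c <= 1]. *)
Lemma expR_sub1_le_trapezoid (R : realType) (x : R) : 0 <= x ->
  expR x - 1 <= x * (1 + expR x) / 2.
Proof.
rewrite le_eqVlt => /predU1P[<-|x0]; first by rewrite expR0; lra.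
pose f : R -> R := (@id R - cst 2) * @expR R + @id R.
have df (t : R) : is_derive t (1 : R) f ((t - 1) * expR t + 1).
  apply: is_derive_eq; rewrite !fctE /GRing.scale /=. ring.
have [|c] := @MVT R f _ _ _ x0 (fun t _ => df t).
  by apply: derivable_within_continuous => t _; apply: ex_derive.
rewrite in_itv /= => /andP[c0 cx]; rewrite /f !fctE expR0 => E.
have h : (1 - c) * expR c <= 1.
  rewrite -[leRHS](mulVf (lt0r_neq0 (expR_gt0 c))) ler_wpM2r ?expR_ge0 //.
  by rewrite -expRN; exact: expR_ge1Dx.
have : 0 <= ((c - 1) * expR c + 1) * (x - 0).
  by rewrite subr0 mulr_ge0 //; lra.
rewrite -E; lra.
Qed.

Lemma expR_trapezoid (R : realType) (x y : R) :
  `|expR y - expR x| <= `|y - x| * ((expR x + expR y) / 2).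
Proof.
wlog xy : x y / x <= y.
  move=> H; have [/H//|/ltW/H] := leP x y.
  by rewrite distrC [`|x - y|]distrC [expR y + _]addrC.
rewrite !ger0_norm ?subr_ge0 ?ler_expR //.
have -> : expR y = expR x * expR (y - x) by rewrite -expRD addrC subrK.
have h : expR (y - x) - 1 <= (y - x) * (1 + expR (y - x)) / 2.
  by apply: expR_sub1_le_trapezoid; rewrite subr_ge0.
have := ler_wpM2l (expR_ge0 x) h; lra.
Qed.

(** * Functional calculus of symmetric matrices *)

Section SpectralFunctions.
Variables (R : realType) (n : nat).
Implicit Types (A B M H Z : 'M[R]_n) (u : 'rV[R]_n).

Definition sqn u : R := (u *m u^T) 0 0.

Definition qform M u : R := (u *m M *m u^T) 0 0.

Lemma sqn_sum u : sqn u = \sum_i u 0 i ^+ 2.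
Proof. by rewrite /sqn mxE; apply: eq_bigr => i _; rewrite mxE expr2. Qed.

Lemma sqn_ge0 u : 0 <= sqn u. Proof. exact: dot_self_ge0. Qed.

Lemma qformD M M' u : qform (M + M') u = qform M u + qform M' u.
Proof. by rewrite /qform mulmxDr mulmxDl mxE. Qed.

Lemma qformB M M' u : qform (M - M') u = qform M u - qform M' u.
Proof. by rewrite /qform mulmxBr mulmxBl mxE [X in _ + X]mxE. Qed.

Lemma qformZ a M u : qform (a *: M) u = a * qform M u.
Proof. by rewrite /qform -scalemxAr -scalemxAl mxE. Qed.

Lemma qform1 u : qform 1%:M u = sqn u.
Proof. by rewrite /qform mulmx1. Qed.

Lemma qform_sum I (r : seq I) (P : pred I) (F : I -> 'M[R]_n) u :
  qform (\sum_(i <- r | P i) F i) u = \sum_(i <- r | P i) qform (F i) u.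
Proof.
elim/big_rec2: _ => [|i x y _ <-]; first by rewrite /qform mulmx0 mul0mx mxE.
by rewrite qformD.
Qed.

Lemma qform_sqr Z u : Z^T = Z -> qform (Z *m Z) u = sqn (u *m Z).
Proof. by move=> ZT; rewrite /qform /sqn trmx_mul ZT !mulmxA. Qed.

Lemma qformE M u : qform M u = \sum_i \sum_j u 0 i * M i j * u 0 j.
Proof.
rewrite /qform mxE exchange_big /=; apply: eq_bigr => j _.
by rewrite !mxE mulr_suml; apply: eq_bigr => i _.
Qed.

(** Fixing one choice makes eigenvectors and eigenvalues functions of A. The rows of the first
    component are the eigenvectors; the default pair is returned exactly when A is not symmetric. *)
Definition eigendecomp A : 'M[R]_n * 'rV[R]_n :=
  xget (1%:M, 0)
    [set Ua | Ua.1 *m Ua.1^T = 1%:M /\ A = Ua.1^T *m diag_mx Ua.2 *m Ua.1]%classic.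

Definition eigvec A := (eigendecomp A).1.
Definition eigval A i := (eigendecomp A).2 0 i.

Definition spectral_fun (f : R -> R) A : 'M[R]_n :=
  (eigvec A)^T *m diag_mx (\row_i f (eigval A i)) *m eigvec A.

Definition mexp := spectral_fun (@expR R).
Definition trexp A : R := \sum_i expR (eigval A i).

Lemma eigendecompP A : A^T = A ->
  eigvec A *m (eigvec A)^T = 1%:M /\ spectral_fun id A = A.
Proof.
move=> /sym_spectral [U [a Ua]].
have [|UU AE] := @xgetPex _ (1%:M, 0) [set Ua : 'M[R]_n * 'rV[R]_n |
   Ua.1 *m Ua.1^T = 1%:M /\ A = Ua.1^T *m diag_mx Ua.2 *m Ua.1]%classic.
  by exists (U, a).
split => //; rewrite [RHS]AE /spectral_fun.
by congr (_ *m diag_mx _ *m _); apply/rowP => i; rewrite mxE.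
Qed.

Lemma eigvecK A : A^T = A -> eigvec A *m (eigvec A)^T = 1%:M.
Proof. by move=> /eigendecompP[]. Qed.

Lemma eigvecKV A : A^T = A -> (eigvec A)^T *m eigvec A = 1%:M.
Proof. by move=> /eigvecK/mulmx1C. Qed.

Lemma spectral_fun_id A : A^T = A -> spectral_fun id A = A.
Proof. by move=> /eigendecompP[]. Qed.

Lemma sqn_eigvec A i : A^T = A -> sqn (row i (eigvec A)) = 1.
Proof.
move=> /eigvecK /matrixP/(_ i i); rewrite [RHS]mxE eqxx => E.
by rewrite -[RHS]E /sqn !mxE; apply: eq_bigr => j _; rewrite !mxE.
Qed.

(** Cyclicity of the trace. Traces against a function of A become combinations of quadratic forms at
    fixed vectors, and it is there that means and variances of a random M are inserted. *)
Lemma tr_spectral_fun f A M :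
  \tr (M *m spectral_fun f A) =
  \sum_i f (eigval A i) * qform M (row i (eigvec A)).
Proof.
rewrite /spectral_fun !mulmxA mxtrace_mulC !mulmxA mul_mx_diag /mxtrace.
apply: eq_bigr => i _; rewrite !mxE mulrC; congr (_ * _).
rewrite /qform -row_mul mxE; apply: eq_bigr => j _.
by rewrite !mxE.
Qed.

Lemma qform_spectral_fun f A u : A^T = A ->
  qform (spectral_fun f A) u =
  \sum_i f (eigval A i) * (u *m (eigvec A)^T) 0 i ^+ 2.
Proof.
move=> Asym; rewrite /qform /spectral_fun !mulmxA.
rewrite -(mulmxA _ (eigvec A)) -{2}[u]trmxK -{2}[eigvec A]trmxK -trmx_mul.
rewrite mxE; apply: eq_bigr => i _.
rewrite mul_mx_diag !mxE [X in _ * X](_ : _ = (u *m (eigvec A)^T) 0 i).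
  by rewrite !mxE; ring.
by rewrite !mxE; apply: eq_bigr => j _; rewrite !mxE.
Qed.

Lemma sqn_eigbasis A u : A^T = A -> sqn u = \sum_i (u *m (eigvec A)^T) 0 i ^+ 2.
Proof.
move=> Asym; rewrite -sqn_sum /sqn trmx_mul trmxK mulmxA -(mulmxA u).
by rewrite eigvecKV // mulmx1.
Qed.

Lemma trexpE A : A^T = A -> trexp A = \tr (mexp A).
Proof.
move=> Asym; rewrite -[mexp A]mul1mx tr_spectral_fun; apply: eq_bigr => i _.
by rewrite qform1 sqn_eigvec // mulr1.
Qed.

Lemma tr_mexp_ge0 A M : (forall u, 0 <= qform M u) -> 0 <= \tr (M *m mexp A).
Proof.
by move=> M0; rewrite tr_spectral_fun sumr_ge0 // => i _; rewrite mulr_ge0 ?expR_ge0.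
Qed.

Lemma trexp_ge_eigval A i : expR (eigval A i) <= trexp A.
Proof.
by rewrite /trexp (bigD1 i) //= lerDl sumr_ge0 // => j _; rewrite expR_ge0.
Qed.

Lemma eigval_qform A i : A^T = A -> eigval A i = qform A (row i (eigvec A)).
Proof.
move=> Asym; rewrite -[A in qform A]spectral_fun_id // qform_spectral_fun //.
rewrite (bigD1 i) //= big1 => [|j ji].
  by rewrite -row_mul eigvecK // row1 !mxE !eqxx expr1n mulr1 addr0.
by rewrite -row_mul eigvecK // row1 !mxE (negbTE ji) expr0n mulr0.
Qed.

Section TwoMatrices.
Variables A B : 'M[R]_n.
Hypotheses (Asym : A^T = A) (Bsym : B^T = B).

(* The entries of M between the eigenbases of A and B; the trace estimates below
   hold entry by entry in this mixed basis, so A and B need not commute. *)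
Let mix M := eigvec A *m M *m (eigvec B)^T.

Lemma mix_spectral_funr f i j :
  mix (spectral_fun f B) i j = mix 1%:M i j * f (eigval B j).
Proof.
rewrite /mix /spectral_fun !mulmxA -(mulmxA _ (eigvec B)) eigvecK // !mulmx1.
by rewrite mul_mx_diag !mxE.
Qed.

Lemma mix_spectral_funl f i j :
  mix (spectral_fun f A) i j = f (eigval A i) * mix 1%:M i j.
Proof.
rewrite /mix /spectral_fun !mulmxA eigvecK // mul1mx !mulmx1 -mulmxA.
by rewrite mul_diag_mx !mxE.
Qed.

Lemma mix_diff f i j : mix (spectral_fun f B - spectral_fun f A) i j =
  (f (eigval B j) - f (eigval A i)) * mix 1%:M i j.
Proof.
rewrite {1}/mix mulmxBr mulmxBl mxE [X in _ + X]mxE.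
rewrite -!/(mix _) mix_spectral_funl mix_spectral_funr; ring.
Qed.

Lemma tr_mix M N : M^T = M -> \tr (M *m N) = \sum_i \sum_j mix M i j * mix N i j.
Proof.
move=> Msym.
have -> : \tr (M *m N) = \tr ((mix M)^T *m mix N).
  rewrite /mix !trmx_mul trmxK Msym !mulmxA [in RHS]mxtrace_mulC !mulmxA.
  rewrite eigvecKV // mul1mx.
  by rewrite -(mulmxA M) eigvecKV // mulmx1.
rewrite /mxtrace exchange_big; apply: eq_bigr => j _.
by rewrite mxE; apply: eq_bigr => i _; rewrite mxE.
Qed.

(** With i fixed, the sum over j is Parseval's identity in the eigenbasis of B, so B disappears from
    the right-hand side. *)
Lemma sum_mixl M f : M^T = M ->
  \sum_i \sum_j mix M i j ^+ 2 * f (eigval A i) = \tr (M *m M *m spectral_fun f A).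
Proof.
move=> Msym; rewrite tr_spectral_fun; apply: eq_bigr => i _.
rewrite -mulr_suml mulrC qform_sqr //; congr (_ * _).
rewrite (sqn_eigbasis _ Bsym); apply: eq_bigr => j _.
by rewrite -!row_mul [in RHS]mxE.
Qed.

Lemma sum_mixr M f : M^T = M ->
  \sum_i \sum_j mix M i j ^+ 2 * f (eigval B j) = \tr (M *m M *m spectral_fun f B).
Proof.
move=> Msym; rewrite tr_spectral_fun exchange_big; apply: eq_bigr => j _.
rewrite -mulr_suml mulrC qform_sqr //; congr (_ * _).
rewrite (sqn_eigbasis _ Asym); apply: eq_bigr => i _; congr (_ ^+ 2).
rewrite -!row_mul [in RHS]mxE.
have -> : eigvec B *m M *m (eigvec A)^T = (mix M)^T.
  by rewrite /mix !trmx_mul trmxK Msym mulmxA.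
by rewrite [in RHS]mxE.
Qed.

Lemma tr_mix_funs f g : \tr (spectral_fun g B *m spectral_fun f A) =
  \sum_i \sum_j mix 1%:M i j ^+ 2 * (g (eigval B j) * f (eigval A i)).
Proof.
rewrite tr_mix.
  apply: eq_bigr => i _; apply: eq_bigr => j _.
  by rewrite mix_spectral_funl mix_spectral_funr; ring.
by rewrite /spectral_fun !trmx_mul trmxK tr_diag_mx mulmxA.
Qed.

(** Klein's inequality, the tangent-line form of the convexity of [trexp]. In the mixed basis it is
    the scalar bound [expR b >= expR a + (b - a) * expR a], averaged with the nonnegative weights
    [mix 1%:M i j ^+ 2]. *)
Lemma trexp_klein : trexp A + \tr ((B - A) *m mexp A) <= trexp B.
Proof.
rewrite !trexpE // mulmxBl.
have e1 : \tr (mexp A) = \sum_i \sum_j mix 1%:M i j ^+ 2 * expR (eigval A i).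
  by rewrite sum_mixl ?trmx1 // !mul1mx.
have e2 : \tr (mexp B) = \sum_i \sum_j mix 1%:M i j ^+ 2 * expR (eigval B j).
  by rewrite sum_mixr ?trmx1 // !mul1mx.
have e3 : \tr (A *m spectral_fun (@expR R) A) =
    \sum_i \sum_j mix 1%:M i j ^+ 2 * (eigval A i * expR (eigval A i)).
  rewrite (sum_mixl (fun x => x * expR x)) ?trmx1 // !mul1mx.
  rewrite -{1}(spectral_fun_id Asym) {1 2}/spectral_fun !mulmxA.
  rewrite -(mulmxA _ (eigvec A)) eigvecK // mulmx1.
  rewrite -(mulmxA _ (diag_mx _) (diag_mx _)) mulmx_diag.
  by congr (\tr (_ *m diag_mx _ *m _)); apply/rowP => i; rewrite !mxE.
have e4 : \tr (B *m spectral_fun (@expR R) A) =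
    \sum_i \sum_j mix 1%:M i j ^+ 2 * (eigval B j * expR (eigval A i)).
  by rewrite -{1}(spectral_fun_id Bsym) tr_mix_funs.
rewrite linearB /= e1 e2 e3 e4 -sumrB -big_split ler_sum // => i _.
rewrite -sumrB -big_split ler_sum // => j _ /=.
rewrite -mulrBr -mulrDr ler_wpM2l ?sqr_ge0 //.
have := ler_wpM2l (expR_ge0 (eigval A i)) (expR_ge1Dx (eigval B j - eigval A i)).
rewrite -expRD [X in _ <= expR X]addrC subrK; lra.
Qed.

(** The trapezoid bound leaves products of an entry of M and an entry of N. The weighted AM-GM
    inequality, with the free weight [c1], splits them into squares, which [sum_mixl] and [sum_mixr]
    reassemble into traces; [c2] is the length of the step from A to B. *)
Lemma tr_mexp_diff_le M N (c1 c2 : R) : M^T = M -> 0 < c1 -> 0 < c2 ->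
  N^T = N -> B - A = c2 *: N ->
  `|\tr (M *m (mexp B - mexp A))| <=
  c2 / 4 * (c1 * \tr (N *m N *m mexp A) + c1 * \tr (N *m N *m mexp B)
          + c1^-1 * \tr (M *m M *m mexp A) + c1^-1 * \tr (M *m M *m mexp B)).
Proof.
move=> Msym c10 c20 Nsym BA; rewrite tr_mix //.
have mixN i j : (eigval B j - eigval A i) * mix 1%:M i j = c2 * mix N i j.
  have := mix_diff id i j; rewrite /= => <-.
  by rewrite !spectral_fun_id // BA /mix -scalemxAr -scalemxAl mxE.
rewrite -!sum_mixl // -!sum_mixr // 4!mulr_sumr -!big_split mulr_sumr /=.
apply: le_trans (ler_norm_sum _ _ _) (ler_sum _ _) => i _.
rewrite 4!mulr_sumr -!big_split mulr_sumr /=.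
apply: le_trans (ler_norm_sum _ _ _) (ler_sum _ _) => j _.
rewrite mix_diff !normrM.
set a := expR (eigval A i); set b := expR (eigval B j).
have h : `|b - a| * `|mix 1%:M i j| <= c2 * `|mix N i j| * ((a + b) / 2).
  have := ler_wpM2r (normr_ge0 (mix 1%:M i j)) (expR_trapezoid (eigval A i) (eigval B j)).
  by rewrite [leRHS]mulrAC -[X in _ <= X * _]normrM mixN normrM (gtr0_norm c20).
apply: le_trans (ler_wpM2l (normr_ge0 _) h) _.
rewrite -[mix N i j ^+ 2]real_normK ?num_real // -[mix M i j ^+ 2]real_normK ?num_real //.
set x := `|mix N i j|; set y := `|mix M i j|.
have ab0 : 0 <= c2 / 4 * (a + b) * c1^-1.
  by rewrite !mulr_ge0 ?invr_ge0 ?addr_ge0 ?expR_ge0 // ltW.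
rewrite -subr_ge0.
have -> : c2 / 4 * (c1 * (x ^+ 2 * a) + c1 * (x ^+ 2 * b)
    + c1^-1 * (y ^+ 2 * a) + c1^-1 * (y ^+ 2 * b)) - y * (c2 * x * ((a + b) / 2))
  = c2 / 4 * (a + b) * c1^-1 * (c1 * x - y) ^+ 2.
  by field; rewrite gt_eqF.
by rewrite mulr_ge0 // sqr_ge0.
Qed.

End TwoMatrices.

End SpectralFunctions.

(** * Second-order expansion of the trace exponential *)

Section ExpTaylor.
Variables (R : realType) (n : nat).
Implicit Types (u : 'rV[R]_n).

Lemma trmxD_sym (A B : 'M[R]_n) : A^T = A -> B^T = B -> (A + B)^T = A + B.
Proof. by move=> AT BT; rewrite linearD /= AT BT. Qed.

Lemma trmxZ_sym a (A : 'M[R]_n) : A^T = A -> (a *: A)^T = a *: A.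
Proof. by move=> AT; rewrite linearZ /= AT. Qed.

Variables (H Z : 'M[R]_n) (r : R).
Hypotheses (Hsym : H^T = H) (Zsym : Z^T = Z) (r0 : 0 < r) (r2 : r < 2).
Hypothesis Zr : forall u, sqn (u *m Z) <= r ^+ 2 * sqn u.

Let T A := \tr (Z *m Z *m mexp A).
Let D A := \tr (Z *m mexp A).

Let T_ge0 A : 0 <= T A.
Proof. by apply: tr_mexp_ge0 => u; rewrite qform_sqr // sqn_ge0. Qed.

Let ZZsym : (Z *m Z)^T = Z *m Z.
Proof. by rewrite trmx_mul Zsym. Qed.

Let T4 A : \tr (Z *m Z *m (Z *m Z) *m mexp A) <= r ^+ 2 * T A.
Proof.
rewrite -subr_ge0 /T -mxtraceZ -linearB /= scalemxAl -mulmxBl.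
apply: tr_mexp_ge0 => u; rewrite qformB qformZ qform_sqr // qform_sqr //.
by rewrite subr_ge0 mulmxA Zr.
Qed.

(** With AM-GM weight r the fourth-order traces cost no more than the second-order ones, because of
    [T4]. The change of T is then at most [s * r / 2] times the sum of its two values; solving for
    the new value is what needs [s * r < 2]. *)
Let T_step A s : A^T = A -> 0 < s -> s * r < 2 ->
  T (A + s *: Z) * (1 - s * r / 2) <= T A * (1 + s * r / 2).
Proof.
move=> Asym s0 sr2.
have Bsym : (A + s *: Z)^T = A + s *: Z by rewrite trmxD_sym ?trmxZ_sym.
have BA : A + s *: Z - A = s *: Z by rewrite addrC addKr.
have := tr_mexp_diff_le Asym Bsym ZZsym r0 s0 Zsym BA.
rewrite mulmxBr linearB /= -/(T _) -/(T _) => h.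
have h1 : r^-1 * \tr (Z *m Z *m (Z *m Z) *m mexp A) <= r * T A.
  by rewrite mulrC ler_pdivrMr // mulrAC -expr2 T4.
have h2 : r^-1 * \tr (Z *m Z *m (Z *m Z) *m mexp (A + s *: Z)) <= r * T (A + s *: Z).
  by rewrite mulrC ler_pdivrMr // mulrAC -expr2 T4.
have h3 := ler_norm (T (A + s *: Z) - T A).
have h4 := ler_wpM2l (ltW s0) (lerD h1 h2).
lra.
Qed.

(** D changes by at most [s / 2] times the sum of T at both ends. By [T_step] the factors
    [1 + s * r / 2] and [1 - s * r / 2] add up to 2, so that sum is at most
    [2 * T H / (1 - s * r / 2)]. *)
Let D_step s : 0 < s -> s <= 1 ->
  D (H + s *: Z) <= D H + s * (T H / (1 - r / 2)).
Proof.
move=> s0 s1.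
have sr : s * r <= r by rewrite ler_piMl // ltW.
have Bsym : (H + s *: Z)^T = H + s *: Z by rewrite trmxD_sym ?trmxZ_sym.
have BA : H + s *: Z - H = s *: Z by rewrite addrC addKr.
have := tr_mexp_diff_le Hsym Bsym Zsym ltr01 s0 Zsym BA.
rewrite invr1 !mul1r mulmxBr linearB /= -/(T _) -/(T _) -/(D _) -/(D _) => h.
have h3 := ler_norm (D (H + s *: Z) - D H).
have sr2 := le_lt_trans sr r2.
have h4 := T_step Hsym s0 sr2.
have c0 : 0 < 1 - s * r / 2 by rewrite subr_gt0 ltr_pdivrMr // mul1r.
have h5 : T (H + s *: Z) + T H <= 2 * (T H / (1 - r / 2)).
  have : (T (H + s *: Z) + T H) * (1 - s * r / 2) <= 2 * T H by lra.
  rewrite -ler_pdivlMr // => /le_trans; apply.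
  rewrite -[leLHS]mulrA; do 2 apply: ler_wpM2l => //.
  rewrite lef_pV2 ?posrE // ?lerD2l ?lerN2 ?ler_pM2r ?invr_gt0 ?ltr0n //.
  by rewrite subr_gt0 ltr_pdivrMr // mul1r.
have := ler_wpM2l (ltW s0) h5; lra.
Qed.

Let f_step s t : 0 <= s -> s < t -> t <= 1 ->
  trexp (H + t *: Z) <= trexp (H + s *: Z) + (t - s) * D (H + t *: Z).
Proof.
move=> s0 st t1.
have sym q : (H + q *: Z)^T = H + q *: Z by rewrite trmxD_sym ?trmxZ_sym.
have := trexp_klein (sym t) (sym s).
have -> : H + s *: Z - (H + t *: Z) = (s - t) *: Z.
  by rewrite opprD addrACA subrr add0r scalerBl.
rewrite -scalemxAl mxtraceZ -/(D _); lra.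
Qed.

Lemma trexp_taylor : trexp (H + Z) <=
  trexp H + \tr (Z *m mexp H) + (1 - r / 2)^-1 / 2 * \tr (Z *m Z *m mexp H).
Proof.
pose c := T H / (1 - r / 2).
have c0 : 0 <= c by rewrite /c divr_ge0 ?T_ge0 // subr_ge0 ler_pdivrMr // mul1r ltW.
(* Only the tangent-line bound [f_step] is iterated; the slope is compared with the one at H
   directly each time. The last term is the right-endpoint Riemann sum of [c * s], which exceeds the
   integral by [c / 2 / N.+1] at the end point. *)
have fN N k : (k <= N.+1)%N ->
  trexp (H + (k%:R / N.+1%:R) *: Z) <= trexp H + k%:R / N.+1%:R * D H
     + c * (k%:R * (k%:R + 1)) / (2 * N.+1%:R ^+ 2).
  have N0 : 0 < N.+1%:R :> R by rewrite ltr0n.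
  elim: k => [|k IHk] kN.
    by rewrite mul0r scale0r addr0 mul0r mul0r mulr0 mul0r !addr0.
  have hk0 : 0 <= k%:R / N.+1%:R :> R by rewrite divr_ge0.
  have hk1 : k%:R / N.+1%:R < k.+1%:R / N.+1%:R :> R.
    by rewrite ltr_pM2r ?invr_gt0 // ltr_nat.
  have hk2 : k.+1%:R / N.+1%:R <= 1 :> R by rewrite ler_pdivrMr // mul1r ler_nat.
  apply: le_trans (f_step hk0 hk1 hk2) _.
  have h := IHk (ltnW kN).
  have h2 := D_step (le_lt_trans hk0 hk1) hk2.
  have dk : k.+1%:R / N.+1%:R - k%:R / N.+1%:R = N.+1%:R^-1 :> R.
    by rewrite -mulrBl -natrB // subSnn mul1r.
  have i0 : 0 <= N.+1%:R^-1 :> R by rewrite invr_ge0 ltW.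
  have := ler_wpM2l i0 h2; rewrite dk -/c => h3.
  apply: le_trans (lerD h h3) _; rewrite le_eqVlt; apply/orP; left; apply/eqP.
  rewrite -[k.+1%:R]natr1; move: (N.+1%:R : R) N0 => q q0; field; by rewrite gt_eqF.
have fN1 N : trexp (H + Z) <= trexp H + D H + c / 2 + c / 2 / N.+1%:R.
  have := fN N _ (leqnn _).
  rewrite divff ?pnatr_eq0 // scale1r mul1r => /le_trans; apply.
  have : (N.+1%:R : R) != 0 by rewrite pnatr_eq0.
  move: (N.+1%:R : R) => q q0.
  by rewrite le_eqVlt; apply/orP; left; apply/eqP; field.
have -> : (1 - r / 2)^-1 / 2 * \tr (Z *m Z *m mexp H) = c / 2.
  by rewrite /c /T; ring.
apply/ler_addgt0Pr => e e0.
pose N := Num.trunc (c / 2 / e).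
apply: le_trans (fN1 N) _; rewrite lerD2l ler_pdivrMr ?ltr0n //.
by rewrite [leRHS]mulrC -ler_pdivrMr // ltW // truncnS_gt.
Qed.

End ExpTaylor.

(** * Product expectations and the matrix Bernstein inequality *)

Section ProductExpectation.
Variables (R : realType) (I T : finType) (p : I -> T -> R).
Hypothesis p_ge0 : forall i k, 0 <= p i k.
Hypothesis p_sum1 : forall i, \sum_k p i k = 1.

Notation Omega := {ffun I -> T}.
Implicit Types (t : Omega) (F G : Omega -> R).

Definition prodwt t : R := \prod_i p i (t i).
Definition expect F : R := \sum_t prodwt t * F t.

Lemma prodwt_ge0 t : 0 <= prodwt t.
Proof. by apply: prodr_ge0 => i _. Qed.

Lemma prodwt_sum1 : \sum_t prodwt t = 1.
Proof. by rewrite /prodwt -bigA_distr_bigA big1. Qed.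

Lemma eq_expect F G : F =1 G -> expect F = expect G.
Proof. by move=> FG; apply: eq_bigr => t _; rewrite FG. Qed.

Lemma expect_cst c : expect (fun _ => c) = c.
Proof. by rewrite /expect -mulr_suml prodwt_sum1 mul1r. Qed.

Lemma expectD F G : expect (fun t => F t + G t) = expect F + expect G.
Proof. by rewrite /expect -big_split; apply: eq_bigr => t _; rewrite mulrDr. Qed.

Lemma expectZ c F : expect (fun t => c * F t) = c * expect F.
Proof. by rewrite /expect mulr_sumr; apply: eq_bigr => t _; rewrite mulrCA. Qed.

Lemma expectB F G : expect (fun t => F t - G t) = expect F - expect G.
Proof. by rewrite /expect -sumrB; apply: eq_bigr => t _; rewrite mulrBr. Qed.

Lemma expect_sum J (r : seq J) (P : pred J) (F : J -> Omega -> R) :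
  expect (fun t => \sum_(j <- r | P j) F j t) = \sum_(j <- r | P j) expect (F j).
Proof.
by rewrite /expect exchange_big; apply: eq_bigr => t _; rewrite mulr_sumr.
Qed.

Lemma expect_le F G : (forall t, F t <= G t) -> expect F <= expect G.
Proof. by move=> FG; apply: ler_sum => t _; rewrite ler_wpM2l ?prodwt_ge0. Qed.

Lemma markov (P : pred Omega) F : (forall t, 0 <= F t) -> (forall t, P t -> 1 <= F t) ->
  \sum_(t | P t) prodwt t <= expect F.
Proof.
move=> F0 F1; rewrite /expect [leRHS](bigID P) /=.
apply: le_trans (_ : \sum_(t | P t) prodwt t * F t <= _).
  by apply: ler_sum => t /F1 h; rewrite ler_peMr ?prodwt_ge0.
by rewrite lerDl sumr_ge0 // => t _; rewrite mulr_ge0 ?prodwt_ge0.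
Qed.

Lemma prob_exists (J : finType) (A : J -> pred Omega) (B : pred Omega) :
  (forall t, B t -> exists j, A j t) ->
  \sum_(t | B t) prodwt t <= \sum_j \sum_(t | A j t) prodwt t.
Proof.
move=> BA; under [leRHS]eq_bigr do rewrite big_mkcond.
rewrite exchange_big [leLHS]big_mkcond; apply: ler_sum => t _ /=.
have w0 j : 0 <= if A j t then prodwt t else 0 by case: ifP; rewrite ?prodwt_ge0.
case: ifPn => [/BA [j Aj]|_]; last exact: sumr_ge0.
by rewrite (bigD1 j) //= Aj lerDl sumr_ge0.
Qed.

(** This is how independence is expressed: a function of the coordinates in S sees only t', and a
    function of the others sees only t. *)
Definition resample (S : {set I}) t t' : Omega := [ffun i => if i \in S then t' i else t i].

(** Exchanging the S-coordinates of two independent outcomes is an involution that preserves the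
    product weight. *)
Lemma expect_resample S F :
  expect F = expect (fun t => expect (fun t' => F (resample S t t'))).
Proof.
pose W (q : Omega * Omega) := prodwt q.1 * prodwt q.2.
pose h (q : Omega * Omega) := (resample S q.1 q.2, resample S q.2 q.1).
have hK : involutive h.
  by case=> t t'; congr pair; apply/ffunP => i; rewrite /= !ffunE; case: (i \in S).
have Wh q : W (h q) = W q.
  rewrite /W /prodwt -!big_split /=; apply: eq_bigr => i _.
  by rewrite !ffunE; case: ifP => // _; rewrite mulrC.
transitivity (\sum_q W q * F q.1).
  rewrite -(pair_big xpredT xpredT (fun t t' => W (t, t') * F t)) /=.
  apply: eq_bigr => t _; rewrite -mulr_suml /W /= -mulr_sumr prodwt_sum1.
  by rewrite mulr1.
rewrite (reindex_inj (inv_inj hK)) /=.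
transitivity (\sum_q W q * F (resample S q.1 q.2)).
  by apply: eq_bigr => q _; rewrite Wh.
rewrite -(pair_big xpredT xpredT (fun t t' => W (t, t') * F (resample S t t'))) /=.
apply: eq_bigr => t _; rewrite /expect mulr_sumr; apply: eq_bigr => t' _.
by rewrite /W /= mulrA.
Qed.

Lemma expect_coord i (f : T -> R) : expect (fun t => f (t i)) = \sum_k p i k * f k.
Proof.
transitivity (\sum_(t : Omega) \prod_j (p j (t j) * (if j == i then f (t j) else 1))).
  apply: eq_bigr => t _; rewrite big_split /=; congr (_ * _).
  by rewrite -big_mkcond big_pred1_eq.
rewrite -(bigA_distr_bigA (fun j k => p j k * (if j == i then f k else 1))).
rewrite (bigD1 i) //= [X in _ * X = _]big1 ?mulr1 => [|j /negbTE ji]; last first.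
  by rewrite -[RHS](p_sum1 j); apply: eq_bigr => k _; rewrite ji mulr1.
by apply: eq_bigr => k _; rewrite eqxx.
Qed.

(** Conditioning on one coordinate, which F must ignore in its first argument. It serves to add a
    draw to counts that do not yet include it. *)
Lemma expect_condition i (F : Omega -> T -> R) :
  (forall t t' k, F (resample [set i] t t') k = F t k) ->
  expect (fun t => F t (t i)) = \sum_k p i k * expect (F^~ k).
Proof.
move=> Fi; rewrite (expect_resample [set i]).
transitivity (expect (fun t => \sum_k p i k * F t k)).
  apply: eq_expect => t; rewrite -expect_coord; apply: eq_expect => t'.
  by rewrite Fi ffunE inE eqxx.
by rewrite expect_sum; apply: eq_bigr => k _; rewrite expectZ.
Qed.

(** * Matrix Bernstein inequality with truncation *)

Section MatrixBernstein.
Variables (n d : nat) (S : 'I_n -> {set I}).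
Variables (Z : 'I_n -> Omega -> 'M[R]_d) (Ev : 'I_n -> pred Omega) (V : 'I_n -> 'M[R]_d).
Variable r : R.
Hypothesis Zsym : forall i t, (Z i t)^T = Z i t.
Hypothesis Vsym : forall i, (V i)^T = V i.
Hypothesis Z_resample : forall i t t', Z i (resample (S i) t t') = Z i t'.
Hypothesis Ev_resample : forall i t t', Ev i (resample (S i) t t') = Ev i t'.
Hypothesis Z_indep : forall i j t t', j != i -> Z j (resample (S i) t t') = Z j t.
Hypothesis Ev_indep : forall i j t t', j != i -> Ev j (resample (S i) t t') = Ev j t.
Hypothesis Z_mean0 : forall i u, expect (fun t => qform (Z i t) u) = 0.
Hypothesis Z_var : forall i u, expect (fun t => sqn (u *m Z i t)) <= qform (V i) u.
Hypothesis Z_bounded : forall i t u, Ev i t -> sqn (u *m Z i t) <= r ^+ 2 * sqn u.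
Hypothesis r_gt0 : 0 < r.

Section Laplace.
Variable theta : R.
Hypothesis theta_gt0 : 0 < theta.
Hypothesis theta_r : theta * r < 2.

Let g := theta ^+ 2 / 2 / (1 - theta * r / 2).

Let g_ge : theta ^+ 2 / 2 <= g.
Proof.
rewrite ler_peMr ?divr_ge0 ?sqr_ge0 // invf_ge1.
  by rewrite lerBlDr lerDl divr_ge0 ?mulr_ge0 // ltW.
by rewrite subr_gt0 ltr_pdivrMr // mul1r.
Qed.

(* Off the event the right-hand side is still nonnegative, because
   1 + x + x^2 / 2 >= 0; this makes recentering of truncated summands unnecessary. *)
Let pointwise i t (A : 'M[R]_d) : A^T = A ->
  (Ev i t)%:R * trexp (A + theta *: Z i t) <=
  trexp A + theta * \tr (Z i t *m mexp A) + g * \tr (Z i t *m Z i t *m mexp A).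
Proof.
move=> Asym; have [Evt|_] := boolP (Ev i t); last first.
  rewrite mul0r trexpE // -!mxtraceZ -!linearD /=.
  rewrite -[X in X + _ + _]mul1mx !scalemxAl -!mulmxDl.
  apply: tr_mexp_ge0 => u; rewrite -?scalemxAl !qformD !qformZ qform1 qform_sqr //.
  set x := sqn u; set y := qform _ _; set z := sqn _.
  (* Completing the square needs only the coefficient [theta ^+ 2 / 4], half of what [g_ge]
     provides. *)
  have h : 0 <= sqn (u + (theta / 2) *: (u *m Z i t)) by exact: sqn_ge0.
  move: h.
  have -> : sqn (u + (theta / 2) *: (u *m Z i t)) = x + theta * y + theta ^+ 2 / 4 * z.
    have -> : z = qform (Z i t *m Z i t) u by rewrite qform_sqr.
    have -> : sqn (u + (theta / 2) *: (u *m Z i t)) =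
        qform ((1%:M + (theta / 2) *: Z i t) *m (1%:M + (theta / 2) *: Z i t)) u.
      rewrite qform_sqr; last by rewrite trmxD_sym ?trmx1 ?trmxZ_sym.
      by rewrite mulmxDr mulmx1 scalemxAr.
    rewrite mulmxDl mul1mx mulmxDr mulmx1 -!scalemxAl -!scalemxAr !qformD !qformZ qform1.
    by rewrite /x /y; field.
  have z0 : 0 <= z by exact: sqn_ge0.
  have := ler_wpM2r z0 g_ge.
  have : 0 <= theta ^+ 2 / 4 * z by rewrite mulr_ge0 ?divr_ge0 ?sqr_ge0.
  lra.
rewrite mul1r.
have tZ u : sqn (u *m (theta *: Z i t)) <= (theta * r) ^+ 2 * sqn u.
  have -> : sqn (u *m (theta *: Z i t)) = theta ^+ 2 * sqn (u *m Z i t).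
    rewrite -!qform_sqr ?trmxZ_sym // -scalemxAl -scalemxAr !qformZ; ring.
  by rewrite exprMn -[leRHS]mulrA ler_wpM2l ?sqr_ge0 // Z_bounded.
have := trexp_taylor Asym (trmxZ_sym theta (Zsym i t)) (mulr_gt0 theta_gt0 r_gt0) theta_r tZ.
rewrite -!scalemxAl -!scalemxAr -!scalemxAl !mxtraceZ /g => /le_trans; apply.
by rewrite lerD2l le_eqVlt; apply/orP; left; apply/eqP; ring.
Qed.

Lemma expect_trexp_step i (A : 'M[R]_d) : A^T = A ->
  expect (fun t => (Ev i t)%:R * trexp (A + theta *: Z i t)) <= trexp (A + g *: V i).
Proof.
move=> Asym; apply: le_trans (expect_le (fun t => pointwise i t Asym)) _.
rewrite !expectD expect_cst !expectZ.
have -> : expect (fun t => \tr (Z i t *m mexp A)) = 0.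
  transitivity (expect (fun t => \sum_j expR (eigval A j) * qform (Z i t) (row j (eigvec A)))).
    by apply: eq_expect => t; rewrite tr_spectral_fun.
  by rewrite expect_sum big1 // => j _; rewrite expectZ Z_mean0 mulr0.
have h : expect (fun t => \tr (Z i t *m Z i t *m mexp A)) <= \tr (V i *m mexp A).
  rewrite (_ : expect _ = expect (fun t => \sum_j expR (eigval A j) *
      sqn (row j (eigvec A) *m Z i t))); last first.
    apply: eq_expect => t; rewrite tr_spectral_fun.
    by apply: eq_bigr => j _; rewrite qform_sqr.
  rewrite expect_sum tr_spectral_fun; apply: ler_sum => j _.
  by rewrite expectZ ler_wpM2l ?expR_ge0.
rewrite mulr0 addr0.
have g0 : 0 <= g by apply: le_trans g_ge; rewrite divr_ge0 ?sqr_ge0.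
apply: le_trans (_ : trexp A + \tr ((g *: V i) *m mexp A) <= _).
  by rewrite -scalemxAl mxtraceZ lerD2l ler_wpM2l.
have Bsym : (A + g *: V i)^T = A + g *: V i by rewrite trmxD_sym ?trmxZ_sym.
by have := trexp_klein Asym Bsym; rewrite [A + _]addrC addrK.
Qed.

(** H is arbitrary so that the induction can absorb [g *: V i] into it. Redrawing the block [S i]
    freezes the other summands, which then belong to the fixed symmetric matrix of
    [expect_trexp_step]. *)
Lemma expect_trexp_sum (s : seq 'I_n) (H : 'M[R]_d) : uniq s -> H^T = H ->
  expect (fun t => (all (Ev^~ t) s)%:R * trexp (H + theta *: \sum_(i <- s) Z i t))
  <= trexp (H + g *: \sum_(i <- s) V i).
Proof.
elim: s H => [|i s IHs] H /=.
  move=> _ _; rewrite big_nil scaler0 addr0.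
  rewrite -[leRHS]expect_cst; apply: expect_le => t.
  by rewrite big_nil scaler0 addr0 mul1r.
move=> /andP[iNs us] Hsym.
have sE (t t' : Omega) : all (Ev^~ (resample (S i) t t')) s = all (Ev^~ t) s.
  apply: eq_in_all => j js; rewrite Ev_indep //.
  by apply: contraNneq iNs => <-.
have sZ (t t' : Omega) : \sum_(j <- s) Z j (resample (S i) t t') = \sum_(j <- s) Z j t.
  rewrite big_seq [RHS]big_seq; apply: eq_bigr => j js; rewrite Z_indep //.
  by apply: contraNneq iNs => <-.
have sumsym t : (\sum_(j <- s) Z j t)^T = \sum_(j <- s) Z j t.
  by rewrite linear_sum /=; apply: eq_bigr => j _.
rewrite (expect_resample (S i)) big_cons scalerDr addrA.
apply: le_trans (IHs (H + g *: V i) us _); last by rewrite trmxD_sym ?trmxZ_sym.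
apply: expect_le => t.
rewrite (_ : expect _ = expect (fun t' => (all (Ev^~ t) s)%:R *
   ((Ev i t')%:R * trexp (H + theta *: (\sum_(j <- s) Z j t) + theta *: Z i t')))); last first.
  apply: eq_expect => t'; rewrite sE Ev_resample big_cons Z_resample sZ.
  rewrite -mulnb natrM [_%:R * _%:R]mulrC -mulrA.
  by rewrite [Z i t' + _]addrC scalerDr addrA.
rewrite expectZ ler_wpM2l // addrAC.
by apply: expect_trexp_step; rewrite trmxD_sym ?trmxZ_sym.
Qed.

End Laplace.

Lemma matrix_laplace (P : pred Omega) (theta s2 x : R) :
  0 < theta -> theta * r < 2 ->
  (forall u, qform (\sum_i V i) u <= s2 * sqn u) ->
  (forall t, P t -> (forall i, Ev i t) /\
     exists u, sqn u = 1 /\ x <= qform (\sum_i Z i t) u) ->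
  \sum_(t | P t) prodwt t <=
    d%:R * expR (theta ^+ 2 / 2 / (1 - theta * r / 2) * s2 - theta * x).
Proof.
move=> theta0 thetar Vs2 Px.
set g := theta ^+ 2 / 2 / _.
have g0 : 0 <= g.
  rewrite /g divr_ge0 ?divr_ge0 ?sqr_ge0 // subr_ge0 ler_pdivrMr // mul1r.
  exact: ltW.
have sym0 : (0 : 'M[R]_d)^T = 0 by rewrite trmx0.
have := expect_trexp_sum theta0 thetar (index_enum_uniq _) sym0.
under eq_expect do rewrite add0r.
rewrite add0r -/g => lapl.
have trV : trexp (g *: \sum_i V i) <= d%:R * expR (g * s2).
  have Wsym : (g *: \sum_i V i)^T = g *: \sum_i V i.
    by rewrite trmxZ_sym // linear_sum /=; apply: eq_bigr => i _.
  rewrite mulr_natl -[d in X in _ <= X]card_ord -sumr_const; apply: ler_sum => i _.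
  rewrite ler_expR eigval_qform // qformZ ler_wpM2l //.
  by apply: le_trans (Vs2 _) _; rewrite sqn_eigvec // mulr1.
rewrite expRD mulrA; apply: le_trans (ler_wpM2r (expR_ge0 _) (le_trans lapl trV)).
rewrite mulrC -expectZ; apply: markov => t.
  by rewrite !mulr_ge0 ?expR_ge0 // sumr_ge0 // => i _; rewrite expR_ge0.
case/Px => Evt [u [u1 xu]].
have -> : all (Ev^~ t) (index_enum 'I_n) by apply/allP => i _; exact: Evt.
rewrite mul1r expRN ler_pdivlMl ?expR_gt0 // mulr1.
set A := theta *: _.
have Asym : A^T = A by rewrite trmxZ_sym // linear_sum /=; apply: eq_bigr => i _.
have Au : theta * x <= qform A u by rewrite qformZ ler_wpM2l // ltW.
(* At a unit vector the quadratic form is a weighted mean of the eigenvalues, so they cannot all lie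
   strictly below [theta * x]. *)
have [i Ai] : exists i, theta * x <= eigval A i.
  apply/existsP; apply: contraTT Au => /existsPn h; rewrite -ltNge.
  rewrite -[A in qform A]spectral_fun_id // qform_spectral_fun //.
  rewrite -[theta * x]mulr1 -u1 (sqn_eigbasis _ Asym) mulr_sumr.
  have le i : eigval A i * (u *m (eigvec A)^T) 0 i ^+ 2 <=
      theta * x * (u *m (eigvec A)^T) 0 i ^+ 2.
    by rewrite ler_wpM2r ?sqr_ge0 // ltW // ltNge h.
  rewrite lt_neqAle ler_sum // andbT; apply/negP => /eqP E.
  have E0 i : (u *m (eigvec A)^T) 0 i ^+ 2 = 0.
    have ge0 j : true -> 0 <= theta * x * (u *m (eigvec A)^T) 0 j ^+ 2 -
        eigval A j * (u *m (eigvec A)^T) 0 j ^+ 2 by rewrite subr_ge0 le.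
    have sum0 : \sum_j (theta * x * (u *m (eigvec A)^T) 0 j ^+ 2 -
        eigval A j * (u *m (eigvec A)^T) 0 j ^+ 2) = 0 by rewrite sumrB E subrr.
    have := psumr_eq0P ge0 sum0 (i := i) isT; rewrite -mulrBl.
    by move/eqP; rewrite mulf_eq0 subr_eq0 gt_eqF ?ltNge ?h //= => /eqP.
  have := u1; rewrite (sqn_eigbasis _ Asym) big1 // => /esym/eqP.
  by rewrite oner_eq0.
by apply: le_trans (trexp_ge_eigval A i); rewrite ler_expR.
Qed.

Lemma matrix_bernstein (P : pred Omega) (s2 L : R) : 0 < s2 -> 0 < L ->
  (forall u, qform (\sum_i V i) u <= s2 * sqn u) ->
  (forall t, P t -> (forall i, Ev i t) /\
     exists u, sqn u = 1 /\ L * r + Num.sqrt (2 * s2 * L) <= qform (\sum_i Z i t) u) ->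
  \sum_(t | P t) prodwt t <= d%:R * expR (- L).
Proof.
move=> s20 L0 Vs2 Px.
set s := Num.sqrt (2 * s2 * L) in Px; pose x := L * r + s.
have s0 : 0 <= s by exact: sqrtr_ge0.
have ss : s ^+ 2 = 2 * s2 * L by rewrite sqr_sqrtr // !mulr_ge0 // ltW.
have x0 : 0 < x by rewrite ltr_wpDr // mulr_gt0.
have y0 : 0 < s2 + r * x / 2 by rewrite addr_gt0 // divr_gt0 // mulr_gt0.
(* The Bernstein choice of theta: [1 - theta * r / 2] becomes [s2 / (s2 + r * x / 2)], and the
   exponent collapses to [- (x ^+ 2 / 2 / (s2 + r * x / 2))]. *)
have theta0 : 0 < x / (s2 + r * x / 2) by rewrite divr_gt0.
apply: le_trans (matrix_laplace theta0 _ Vs2 Px) _.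
  rewrite mulrAC ltr_pdivrMr // -subr_gt0 (_ : _ - _ = 2 * s2); last by field.
  by rewrite mulr_gt0.
rewrite ler_wpM2l // ler_expR -/x.
have -> : (x / (s2 + r * x / 2)) ^+ 2 / 2 / (1 - x / (s2 + r * x / 2) * r / 2) * s2 -
    x / (s2 + r * x / 2) * x = - (x ^+ 2 / 2 / (s2 + r * x / 2)).
  have d1 : 1 - x / (s2 + r * x / 2) * r / 2 = s2 / (s2 + r * x / 2).
    by field; rewrite ?gt_eqF //; lra.
  rewrite d1; field; rewrite !gt_eqF //; lra.
rewrite lerN2 ler_pdivlMr // ler_pdivlMr // -subr_ge0.
have -> : x ^+ 2 - L * (s2 + r * x / 2) * 2 = L * r * s.
  transitivity (L * r * s + (s ^+ 2 - 2 * s2 * L)); last by rewrite ss subrr addr0.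
  by rewrite /x; field.
by rewrite !mulr_ge0 // ltW.
Qed.

End MatrixBernstein.

End ProductExpectation.

(** * Moments of the sample counts *)

(** Free of any condition on n and k: once k exceeds n the falling factorial is already zero, so the
    negative factor does no harm. *)
Lemma ffactS_natr (R : comNzRingType) (n k : nat) :
  (n ^_ k.+1)%:R = (n ^_ k)%:R * (n%:R - k%:R) :> R.
Proof.
rewrite ffactnSr; have [kn|nk] := leqP k n; first by rewrite natrM natrB.
by rewrite ffact_small // mul0n mul0r.
Qed.

(** The discrete derivative of the falling factorial: one more draw changes factorial moments by a
    linear recurrence. *)
Lemma ffact_succ n k : (n.+1 ^_ k = n ^_ k + k * n ^_ k.-1)%N.
Proof.
case: k => [|k]; first by rewrite !ffactn0.
rewrite ffactSS ffactnSr /= [(_ ^_ _ * _)%N]mulnC -mulnDl.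
have [kn|nk] := leqP k n; last by rewrite ffact_small // !muln0.
by rewrite addnS subnK.
Qed.

Section Counts.
Variables (R : realType) (I T : finType) (p : I -> T -> R).
Hypothesis p_ge0 : forall i k, 0 <= p i k.
Hypothesis p_sum1 : forall i, \sum_k p i k = 1.
Variables (m : nat) (e : 'I_m -> I) (q : T -> R).
Hypothesis e_inj : injective e.
Hypothesis p_e : forall j k, p (e j) k = q k.
Notation Omega := {ffun I -> T}.
Notation Ex := (expect p).

(** [e] lists the draws belonging to one column; the cut-off h allows induction on the number of
    draws. *)
Definition count_upto h (t : Omega) : {ffun T -> nat} :=
  [ffun k => \sum_(j < m | (j < h)%N) (t (e j) == k)]%N.

Lemma count_upto0 t k : count_upto 0 t k = 0%N.
Proof. by rewrite ffunE big_pred0. Qed.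

Lemma count_uptoS h (hm : (h < m)%N) t k :
  count_upto h.+1 t k = (count_upto h t k + (t (e (Ordinal hm)) == k))%N.
Proof.
rewrite !ffunE (bigD1 (Ordinal hm)) //= addnC; congr (_ + _)%N.
apply: eq_bigl => j; rewrite -val_eqE /= ltnS ltn_neqAle andbC.
by case: ltngtP.
Qed.

Lemma expect_countS h (hm : (h < m)%N) (G : {ffun T -> nat} -> T -> R) :
  Ex (fun t => G (count_upto h t) (t (e (Ordinal hm)))) =
  \sum_k q k * Ex (fun t => G (count_upto h t) k).
Proof.
rewrite (@expect_condition _ _ _ _ p_sum1 _ (fun t k => G (count_upto h t) k)).
  by apply: eq_bigr => k _; rewrite p_e.
move=> t t' k; congr (G _ _); apply/ffunP => l; rewrite !ffunE.
apply: eq_bigr => j jh; rewrite ffunE inE; case: (e j =P _) => // /e_inj jE.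
by rewrite jE /= ltnn in jh.
Qed.

Lemma q_sum1 (j : 'I_m) : \sum_k q k = 1.
Proof. by rewrite -[RHS](p_sum1 (e j)); apply: eq_bigr => k _; rewrite p_e. Qed.

(** The generating function of a binomial count, evaluated later at the square root of e for the
    Chernoff bound. *)
Lemma expect_pow_count (s : R) h a : (h <= m)%N ->
  Ex (fun t => s ^+ count_upto h t a) = (1 + q a * (s - 1)) ^+ h.
Proof.
elim: h => [|h IHh] hm.
  rewrite -[RHS](expect_cst p_sum1); apply: eq_expect => t.
  by rewrite count_upto0.
transitivity (Ex (fun t => s ^+ count_upto h t a * s ^+ (t (e (Ordinal hm)) == a))).
  by apply: eq_expect => t; rewrite count_uptoS exprD.
rewrite (expect_countS hm (fun N k => s ^+ N a * s ^+ (k == a))).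
have pick k : q k * Ex (fun t => s ^+ count_upto h t a * s ^+ (k == a)) =
    (q k + q k * (k == a)%:R * (s - 1)) * (1 + q a * (s - 1)) ^+ h.
  rewrite -(IHh (ltnW hm)) -mulrA -[X in (X + _) * _]mulr1 -mulrDr -mulrA; congr (_ * _).
  rewrite -expectZ; apply: eq_expect => t.
  by case: (k == a); rewrite ?expr1 ?expr0 /=; ring.
under eq_bigr do rewrite pick.
rewrite -mulr_suml exprS big_split /= (q_sum1 (Ordinal hm)) -mulr_suml.
rewrite (bigD1 a) //= eqxx mulr1 big1 ?addr0 // => k /negbTE ->.
by rewrite mulr0.
Qed.

(** Three categories are enough: an entry of the squared sketch involves a row, a column and one
    intermediate index. *)
Lemma expect_ffact3 h a b c ra rb rc : (h <= m)%N -> a != b -> a != c -> b != c ->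
  Ex (fun t => (count_upto h t a ^_ ra)%:R * (count_upto h t b ^_ rb)%:R *
     (count_upto h t c ^_ rc)%:R) =
  (h ^_ (ra + rb + rc))%:R * q a ^+ ra * q b ^+ rb * q c ^+ rc.
Proof.
move=> hm ab ac bc; elim: h hm ra rb rc => [|h IHh] hm ra rb rc.
  rewrite -[RHS](expect_cst p_sum1); apply: eq_expect => t; rewrite !count_upto0.
  by case: ra => [|ra]; case: rb => [|rb]; case: rc => [|rc];
    rewrite ?ffactn0 ?ffact0n ?addnS ?mulr0 ?mul0r ?mulr1.
pose F (x y z : nat) (N : {ffun T -> nat}) : R :=
  (N a ^_ x)%:R * (N b ^_ y)%:R * (N c ^_ z)%:R.
(* The monomial after one more draw, with value k. At most one correction is active, and the
   truncated predecessor of a zero exponent is harmless because its coefficient vanishes. *)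
pose G (N : {ffun T -> nat}) k := F ra rb rc N
   + (k == a)%:R * (ra%:R * F ra.-1 rb rc N)
   + (k == b)%:R * (rb%:R * F ra rb.-1 rc N)
   + (k == c)%:R * (rc%:R * F ra rb rc.-1 N).
transitivity (Ex (fun t => G (count_upto h t) (t (e (Ordinal hm))))).
  apply: eq_expect => t; rewrite !count_uptoS /G /F.
  move: (t (e (Ordinal hm))) (count_upto h t) => k N.
  have [->|ka] := eqVneq k a.
    rewrite (negbTE ab) (negbTE ac) !addn0 addn1 ffact_succ natrD natrM /=; ring.
  have [->|kb] := eqVneq k b.
    rewrite (negbTE bc) !addn0 addn1 ffact_succ natrD natrM /=; ring.
  have [_|_] := eqVneq k c.
    rewrite !addn0 addn1 ffact_succ natrD natrM /=; ring.
  rewrite !addn0 /=; ring.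
rewrite expect_countS.
have GE k : q k * Ex (fun t => G (count_upto h t) k) =
    q k * Ex (fun t => F ra rb rc (count_upto h t))
    + q k * ((k == a)%:R * (ra%:R * Ex (fun t => F ra.-1 rb rc (count_upto h t))))
    + q k * ((k == b)%:R * (rb%:R * Ex (fun t => F ra rb.-1 rc (count_upto h t))))
    + q k * ((k == c)%:R * (rc%:R * Ex (fun t => F ra rb rc.-1 (count_upto h t)))).
  by rewrite -!mulrDr; congr (_ * _); rewrite -!expectZ -!expectD.
under eq_bigr do rewrite GE.
rewrite !big_split /= -mulr_suml (q_sum1 (Ordinal hm)) mul1r.
have pick l (x : R) : \sum_k q k * ((k == l)%:R * x) = q l * x.
  rewrite (bigD1 l) //= eqxx mul1r big1 ?addr0 // => k /negbTE ->.
  by rewrite mul0r mulr0.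
rewrite !pick /F.
rewrite !(IHh (ltnW hm)).
set qm := q a ^+ ra * q b ^+ rb * q c ^+ rc.
set l := (ra + rb + rc)%N.
have la : q a * (ra%:R * ((h ^_ (ra.-1 + rb + rc))%:R * q a ^+ ra.-1 * q b ^+ rb * q c ^+ rc)) =
    (ra * h ^_ l.-1)%:R * qm.
  rewrite /qm /l; case: (ra) => [|x]; first by rewrite mul0n !mul0r mulr0.
  by rewrite natrM exprS /=; ring.
have lb : q b * (rb%:R * ((h ^_ (ra + rb.-1 + rc))%:R * q a ^+ ra * q b ^+ rb.-1 * q c ^+ rc)) =
    (rb * h ^_ l.-1)%:R * qm.
  rewrite /qm /l; case: (rb) => [|x]; first by rewrite mul0n !mul0r mulr0.
  by rewrite natrM exprS addnS /=; ring.
have lc : q c * (rc%:R * ((h ^_ (ra + rb + rc.-1))%:R * q a ^+ ra * q b ^+ rb * q c ^+ rc.-1)) =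
    (rc * h ^_ l.-1)%:R * qm.
  rewrite /qm /l; case: (rc) => [|x]; first by rewrite mul0n !mul0r mulr0.
  by rewrite natrM exprS addnS /=; ring.
have lR : l%:R = ra%:R + rb%:R + rc%:R :> R by rewrite /l !natrD.
by rewrite la lb lc ffact_succ natrD !natrM lR /qm; ring.
Qed.

End Counts.

(** * The variance of one summand *)

Lemma cauchy_schwarz_sum (R : realFieldType) (I : finType) (f g : I -> R) :
  (\sum_i f i * g i) ^+ 2 <= (\sum_i f i ^+ 2) * (\sum_i g i ^+ 2).
Proof.
set T := \sum_i f i * g i; set G := \sum_i g i ^+ 2; set F := \sum_i f i ^+ 2.
have [G0|G0] := eqVneq G 0.
  have g0 i : g i = 0.
    have := psumr_eq0P (fun i _ => sqr_ge0 (g i)) G0 (i := i) isT.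
    by move/eqP; rewrite sqrf_eq0 => /eqP.
  by rewrite /T big1 ?expr0n ?G0 ?mulr0 // => i _; rewrite g0 mulr0.
have Gge0 : 0 <= G by apply: sumr_ge0 => i _; rewrite sqr_ge0.
have Gpos : 0 < G by rewrite lt_neqAle eq_sym G0.
rewrite -subr_ge0 -(pmulr_rge0 _ Gpos).
rewrite (_ : G * _ = \sum_i (G * f i - T * g i) ^+ 2); last first.
  transitivity (\sum_i (G ^+ 2 * f i ^+ 2 - 2 * G * T * (f i * g i) + T ^+ 2 * g i ^+ 2)).
    by rewrite big_split sumrB /= -!mulr_sumr -/T -/G -/F; ring.
  by apply: eq_bigr => i _; ring.
by apply: sumr_ge0 => i _; rewrite sqr_ge0.
Qed.

Section Variance.
Variables (R : realType) (I : finType) (d : nat) (p : I -> 'I_d -> R).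
Hypothesis p_ge0 : forall i k, 0 <= p i k.
Hypothesis p_sum1 : forall i, \sum_k p i k = 1.
Variables (m : nat) (e : 'I_m -> I) (q : 'I_d -> R).
Hypothesis e_inj : injective e.
Hypothesis p_e : forall j k, p (e j) k = q k.
Hypothesis m_gt1 : (1 < m)%N.
Hypothesis d_gt2 : (2 < d)%N.
Notation Omega := {ffun I -> 'I_d}.
Notation Ex := (expect p).

Definition Ncount (t : Omega) k : R := (count_upto e m t k)%:R.
Let N := Ncount.
Let mu : R := m%:R.

Let ffactR k n : (n ^_ k)%:R = \prod_(i < k) (n%:R - i%:R) :> R.
Proof.
elim: k => [|k IHk]; first by rewrite ffactn0 big_ord0.
by rewrite ffactS_natr IHk big_ord_recr.
Qed.

Let M (a b c : 'I_d) (ra rb rc : nat) (t : Omega) : R := (count_upto e m t a ^_ ra)%:R *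
  (count_upto e m t b ^_ rb)%:R * (count_upto e m t c ^_ rc)%:R.

Let expectM a b c ra rb rc : a != b -> a != c -> b != c ->
  Ex (M a b c ra rb rc) =
  \prod_(i < ra + rb + rc) (mu - i%:R) * q a ^+ ra * q b ^+ rb * q c ^+ rc.
Proof.
move=> ab ac bc; rewrite -ffactR.
exact (expect_ffact3 p_sum1 e_inj p_e ra rb rc (leqnn m) ab ac bc).
Qed.

(** Supplies a dummy category, taken with exponent 0, so that moments of one or two counts are
    instances of [expect_ffact3]. *)
Let third (a b : 'I_d) : exists c, (a != c) && (b != c).
Proof.
case: (pickP (fun c => (a != c) && (b != c))) => [c abc|ab]; first by exists c.
have : (#|[set: 'I_d]| <= #|[set a; b]|)%N.
  apply: subset_leq_card; apply/fintype.subsetP => c _; rewrite !inE.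
  by move/negbT: (ab c); rewrite negb_and !negbK ![c == _]eq_sym.
rewrite cardsT card_ord leqNgt => /negP[].
by apply: leq_ltn_trans d_gt2; rewrite cards2; case: (a != b).
Qed.

Let bigE := (big_ord0, big_ord_recr).

Let E_NNNN a b c : a != b -> a != c -> b != c ->
  Ex (fun t => N t a * N t b * N t c ^+ 2) =
  mu * (mu - 1) * (mu - 2) * (mu - 3) * q a * q b * q c ^+ 2
  + mu * (mu - 1) * (mu - 2) * q a * q b * q c.
Proof.
move=> ab ac bc; transitivity (Ex (M a b c 1 1 2) + Ex (M a b c 1 1 1)).
  rewrite -expectD; apply: eq_expect => t; rewrite /M !ffactR !bigE /= /N /Ncount.
  ring.
rewrite !expectM // !bigE /=; ring.
Qed.

Let E_NN a b : a != b -> Ex (fun t => N t a * N t b) = mu * (mu - 1) * q a * q b.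
Proof.
move=> ab; have [c /andP[ac bc]] := third a b.
transitivity (Ex (M a b c 1 1 0)).
  apply: eq_expect => t; rewrite /M !ffactR !bigE /= /N /Ncount; ring.
rewrite !expectM // !bigE /=; ring.
Qed.

Let E_N3N a b : a != b -> Ex (fun t => N t a ^+ 3 * N t b) =
  mu * (mu - 1) * (mu - 2) * (mu - 3) * q a ^+ 3 * q b
  + 3 * (mu * (mu - 1) * (mu - 2)) * q a ^+ 2 * q b
  + mu * (mu - 1) * q a * q b.
Proof.
move=> ab; have [c /andP[ac bc]] := third a b.
transitivity (Ex (M a b c 3 1 0) + 3 * Ex (M a b c 2 1 0) + Ex (M a b c 1 1 0)).
  rewrite -expectZ -!expectD; apply: eq_expect => t.
  rewrite /M !ffactR !bigE /= /N /Ncount; ring.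
rewrite !expectM // !bigE /=; ring.
Qed.

Let E_N2N2 a b : a != b -> Ex (fun t => N t a ^+ 2 * N t b ^+ 2) =
  mu * (mu - 1) * (mu - 2) * (mu - 3) * q a ^+ 2 * q b ^+ 2
  + mu * (mu - 1) * (mu - 2) * (q a ^+ 2 * q b + q a * q b ^+ 2)
  + mu * (mu - 1) * q a * q b.
Proof.
move=> ab; have [c /andP[ac bc]] := third a b.
transitivity (Ex (M a b c 2 2 0) + Ex (M a b c 2 1 0) + Ex (M a b c 1 2 0)
   + Ex (M a b c 1 1 0)).
  rewrite -!expectD; apply: eq_expect => t.
  rewrite /M !ffactR !bigE /= /N /Ncount; ring.
rewrite !expectM // !bigE /=; ring.
Qed.

Let E_N2 a : Ex (fun t => N t a ^+ 2) = mu * (mu - 1) * q a ^+ 2 + mu * q a.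
Proof.
have [b /andP[ab _]] := third a a; have [c /andP[ac bc]] := third a b.
transitivity (Ex (M a b c 2 0 0) + Ex (M a b c 1 0 0)).
  rewrite -!expectD; apply: eq_expect => t.
  rewrite /M !ffactR !bigE /= /N /Ncount; ring.
rewrite !expectM // !bigE /=; ring.
Qed.

(** The coefficients 1, 6, 7, 1 are the Stirling numbers of the second kind that expand a fourth
    power in falling factorials. *)
Let E_N4 a : Ex (fun t => N t a ^+ 4) =
  mu * (mu - 1) * (mu - 2) * (mu - 3) * q a ^+ 4
  + 6 * (mu * (mu - 1) * (mu - 2)) * q a ^+ 3
  + 7 * (mu * (mu - 1)) * q a ^+ 2 + mu * q a.
Proof.
have [b /andP[ab _]] := third a a; have [c /andP[ac bc]] := third a b.
transitivity (Ex (M a b c 4 0 0) + 6 * Ex (M a b c 3 0 0)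
   + 7 * Ex (M a b c 2 0 0) + Ex (M a b c 1 0 0)).
  rewrite -!expectZ -!expectD; apply: eq_expect => t.
  rewrite /M !ffactR !bigE /= /N /Ncount; ring.
rewrite !expectM // !bigE /=; ring.
Qed.

Variables (x v : 'I_d -> R).
Hypothesis qv : forall k, q k * v k = x k.
Hypothesis q_ge0 : forall k, 0 <= q k.

Definition shrink k : R := (1 + (mu - 1) * q k)^-1.
Let b := shrink.

(* For a single column x, with v = x / q, this is n times its summand of C_e; its
   mean is target = x x^T. *)
Definition sketch t : 'M[R]_d := \matrix_(k, l)
  (mu / (mu - 1) * (v k * N t k / mu * (v l * N t l / mu)) * (1 - (k == l)%:R * b k)).
Let Q := sketch.

Let mu_neq0 : mu != 0.
Proof. by rewrite pnatr_eq0 -lt0n ltnW. Qed.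
Let mu1_neq0 : mu - 1 != 0.
Proof. by rewrite subr_eq0 (eqr_nat _ m 1) gtn_eqF. Qed.
Let mu1_gt0 : 0 < mu - 1.
Proof. by rewrite subr_gt0 ltr1n. Qed.
Let bden_neq0 k : 1 + (mu - 1) * q k != 0.
Proof. by rewrite gt_eqF // ltr_wpDr // mulr_ge0 // ltW. Qed.

(** Each [g] with index s is the falling factorial of mu of order s times the normalisation
    [(mu / (mu - 1)) ^+ 2 / mu ^+ 4]. *)
Let g4 := (mu - 2) * (mu - 3) / (mu * (mu - 1)).
Let g3 := (mu - 2) / (mu * (mu - 1)).
Let g2 := (mu * (mu - 1))^-1.
Let g1 := (mu * (mu - 1) ^+ 2)^-1.

(** This explains the value of [b]. A squared count has mean [mu * q k * (1 + (mu - 1) * q k)], and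
    the factor [1 - b k] reduces it to [mu * (mu - 1) * q k ^+ 2], matching the off-diagonal
    moments. *)
Lemma expect_sketch k l : Ex (fun t => Q t k l) = x k * x l.
Proof.
have [<-|kl] := eqVneq k l.
  transitivity ((v k / mu) ^+ 2 * (mu / (mu - 1)) * (1 - b k) * Ex (fun t => N t k ^+ 2)).
    rewrite -expectZ; apply: eq_expect => t; rewrite mxE eqxx mul1r -/b.
    by field; rewrite mu_neq0 mu1_neq0.
  rewrite E_N2 -!qv /b /shrink; field.
  by rewrite mu_neq0 mu1_neq0 bden_neq0.
transitivity (v k * v l / mu ^+ 2 * (mu / (mu - 1)) * Ex (fun t => N t k * N t l)).
  rewrite -expectZ; apply: eq_expect => t; rewrite mxE (negbTE kl) mul0r.
  by field; rewrite mu_neq0 mu1_neq0.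
by rewrite E_NN // -!qv; field; rewrite mu_neq0 mu1_neq0.
Qed.

Let E_off k l j : k != l -> j != k -> j != l ->
  Ex (fun t => Q t k j * Q t j l) = x k * x l * (g4 * x j ^+ 2 + g3 * (x j * v j)).
Proof.
move=> kl jk jl.
transitivity (v k * v l * v j ^+ 2 / mu ^+ 4 * (mu / (mu - 1)) ^+ 2 *
   Ex (fun t => N t k * N t l * N t j ^+ 2)).
  rewrite -expectZ; apply: eq_expect => t.
  rewrite !mxE (negbTE jl) eq_sym (negbTE jk) !mul0r.
  by field; rewrite mu_neq0 mu1_neq0.
rewrite E_NNNN // 1?eq_sym // -!qv /g4 /g3.
by field; rewrite mu_neq0 mu1_neq0.
Qed.

Let h k := (1 - b k) * (g4 * x k ^+ 2 + 3 * g3 * (x k * v k) + g2 * v k ^+ 2).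

Let E_offk k l : k != l -> Ex (fun t => Q t k k * Q t k l) = x k * x l * h k.
Proof.
move=> kl.
transitivity (v k ^+ 3 * v l / mu ^+ 4 * (mu / (mu - 1)) ^+ 2 * (1 - b k) *
   Ex (fun t => N t k ^+ 3 * N t l)).
  rewrite -expectZ; apply: eq_expect => t.
  rewrite !mxE (negbTE kl) eqxx mul1r mul0r -/b.
  by field; rewrite mu_neq0 mu1_neq0.
rewrite E_N3N // /h -!qv /g4 /g3 /g2.
by field; rewrite mu_neq0 mu1_neq0.
Qed.

Let Qsym t k l : Q t k l = Q t l k.
Proof.
by rewrite !mxE [l == k]eq_sym; have [->|_] := eqVneq k l; rewrite ?mul0r //; ring.
Qed.

Let E_offl k l : k != l -> Ex (fun t => Q t k l * Q t l l) = x k * x l * h l.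
Proof.
rewrite eq_sym => lk; rewrite [x k * _]mulrC -E_offk //; apply: eq_expect => t.
by rewrite mulrC [Q t k l]Qsym.
Qed.

Let E_diag k j : j != k -> Ex (fun t => Q t k j * Q t j k) =
  g4 * x k ^+ 2 * x j ^+ 2 + g3 * (x k ^+ 2 * (x j * v j) + x k * v k * x j ^+ 2)
  + g2 * (x k * v k) * (x j * v j).
Proof.
move=> jk.
transitivity (v k ^+ 2 * v j ^+ 2 / mu ^+ 4 * (mu / (mu - 1)) ^+ 2 *
   Ex (fun t => N t k ^+ 2 * N t j ^+ 2)).
  rewrite -expectZ; apply: eq_expect => t.
  rewrite !mxE [k == j]eq_sym (negbTE jk) !mul0r.
  by field; rewrite mu_neq0 mu1_neq0.
rewrite E_N2N2 1?eq_sym // -!qv /g4 /g3 /g2.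
by field; rewrite mu_neq0 mu1_neq0.
Qed.

Let E_diagk k : Ex (fun t => Q t k k * Q t k k) =
  (1 - b k) ^+ 2 * (g4 * x k ^+ 4 + 6 * g3 * x k ^+ 2 * (x k * v k)
    + 7 * g2 * (x k * v k) ^+ 2 + g1 * (x k * v k) * v k ^+ 2).
Proof.
transitivity (v k ^+ 4 / mu ^+ 4 * (mu / (mu - 1)) ^+ 2 * (1 - b k) ^+ 2 *
   Ex (fun t => N t k ^+ 4)).
  rewrite -expectZ; apply: eq_expect => t.
  rewrite !mxE eqxx mul1r -/b.
  by field; rewrite mu_neq0 mu1_neq0.
rewrite E_N4 -!qv /g4 /g3 /g2 /g1.
by field; rewrite mu_neq0 mu1_neq0.
Qed.

Let P := \sum_k x k * v k.
Let X2 := \sum_k x k ^+ 2.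
(** Bookkeeping for the mean of the squared sketch: [phi] is the contribution of a generic
    intermediate index j, [cor] the correction when j meets the row or column index, and [dev] what
    remains on the diagonal. *)
Let phi j := g4 * x j ^+ 2 + g3 * (x j * v j).
Let cor k := h k - phi k.
Let dev k := g4 * (x k ^+ 4 * b k ^+ 2) - 6 * g3 * (b k * (1 - b k) * (x k ^+ 2 * (x k * v k)))
  + g3 * (x k * v k * X2)
  + g2 * (x k * v k * P + (7 * (1 - b k) ^+ 2 - 2 * (1 - b k) - 1) * (x k * v k) ^+ 2)
  + g1 * ((1 - b k) ^+ 2 * (x k * v k * v k ^+ 2)).

Let sum_phi : \sum_j phi j = g4 * X2 + g3 * P.
Proof. by rewrite big_split /= -!mulr_sumr. Qed.

Let pick (l : 'I_d) (F : R) : \sum_j (j == l)%:R * F = F.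
Proof.
rewrite (bigD1 l) //= eqxx mul1r big1 ?addr0 // => j /negbTE ->.
by rewrite mul0r.
Qed.

Let expect_sqr k l : \sum_j Ex (fun t => Q t k j * Q t j l) =
  x k * x l * (g4 * X2 + g3 * P + cor k + cor l) + (k == l)%:R * dev k.
Proof.
have [<-|kl] := eqVneq k l; last first.
  rewrite mul0r addr0.
  transitivity (\sum_j (x k * x l * phi j + (j == k)%:R * (x k * x l * cor k)
      + (j == l)%:R * (x k * x l * cor l))).
    apply: eq_bigr => j _; have [->|jk] := eqVneq j k.
      by rewrite E_offk // (negbTE kl) /cor /=; ring.
    have [->|jl] := eqVneq j l; first by rewrite E_offl // /cor /=; ring.
    by rewrite E_off // /phi /=; ring.
  by rewrite !big_split /= !pick -mulr_sumr sum_phi; ring.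
pose c k := (1 - b k) ^+ 2 * (g4 * x k ^+ 4 + 6 * g3 * x k ^+ 2 * (x k * v k)
    + 7 * g2 * (x k * v k) ^+ 2 + g1 * (x k * v k) * v k ^+ 2)
  - (x k ^+ 2 * phi k + g3 * (x k * v k) * x k ^+ 2 + g2 * (x k * v k) * (x k * v k)).
transitivity (\sum_j (x k ^+ 2 * phi j + g3 * (x k * v k) * x j ^+ 2
    + g2 * (x k * v k) * (x j * v j) + (j == k)%:R * c k)).
  apply: eq_bigr => j _; have [->|jk] := eqVneq j k.
    by rewrite E_diagk /c /phi /=; ring.
  by rewrite E_diag // /phi /=; ring.
rewrite !big_split /= pick -!mulr_sumr sum_phi -/X2 -/P /c /dev /cor /h /phi; ring.
Qed.

Definition target : 'M[R]_d := \matrix_(k, l) (x k * x l).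

Let expect_var u : Ex (fun t => sqn (u *m (Q t - target))) =
  (g4 * X2 + g3 * P - X2) * (\sum_k u 0 k * x k) ^+ 2
  + 2 * (\sum_k u 0 k * x k) * (\sum_k u 0 k * x k * cor k)
  + \sum_k u 0 k ^+ 2 * dev k.
Proof.
have symQ t : (Q t - target)^T = Q t - target.
  rewrite linearB /=; congr (_ - _); apply/matrixP => k l; rewrite mxE.
    exact: Qsym.
  by rewrite !mxE mulrC.
transitivity (\sum_k \sum_l \sum_j
    Ex (fun t => u 0 k * u 0 l * ((Q t k j - x k * x j) * (Q t j l - x j * x l)))).
  under eq_bigr do (under eq_bigr do rewrite -expect_sum; rewrite -expect_sum).
  rewrite -expect_sum; apply: eq_expect => t.
  rewrite -qform_sqr // qformE; apply: eq_bigr => k _; apply: eq_bigr => l _.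
  rewrite mxE mulrAC mulr_sumr; apply: eq_bigr => j _; congr (_ * (_ * _));
    by rewrite [LHS]mxE [X in _ + X]mxE [target _ _]mxE.
transitivity (\sum_k \sum_l (u 0 k * u 0 l *
   (x k * x l * (g4 * X2 + g3 * P - X2 + cor k + cor l) + (k == l)%:R * dev k))).
  apply: eq_bigr => k _; apply: eq_bigr => l _.
  rewrite [x k * x l * _](_ : _ = x k * x l * (g4 * X2 + g3 * P + cor k + cor l)
     - x k * x l * X2); last by ring.
  rewrite addrAC -expect_sqr /X2 mulr_sumr -sumrB mulr_sumr; apply: eq_bigr => j _.
  rewrite expectZ; congr (_ * _).
  transitivity (Ex (fun t => Q t k j * Q t j l) - x j * x l * Ex (fun t => Q t k j)
     - x k * x j * Ex (fun t => Q t j l) + x k * x j * (x j * x l)).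
    rewrite -!expectZ -[X in _ + X](expect_cst p_sum1) -!expectB -expectD.
    by apply: eq_expect => t; ring.
  by rewrite !expect_sketch; ring.
pose s := \sum_k u 0 k * x k.
transitivity (\sum_k (u 0 k * x k * (g4 * X2 + g3 * P - X2) * s
   + u 0 k * x k * cor k * s
   + u 0 k * x k * (\sum_l u 0 l * x l * cor l) + u 0 k ^+ 2 * dev k)).
  apply: eq_bigr => k _; rewrite /s !mulr_sumr -!big_split /=.
  rewrite -[u 0 k ^+ 2 * dev k](pick k) -big_split /=; apply: eq_bigr => l _.
  by rewrite eq_sym; have [->|_] := eqVneq l k; rewrite /=; ring.
by rewrite !big_split /= -!mulr_suml -/s; ring.
Qed.

(** * Upper bounds for the exact variance *)

Variables (al Y : R).
Hypothesis al01 : 0 < al < 1.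
Hypothesis xv_ge0 : forall k, 0 <= x k * v k.
Hypothesis xv_le : forall k, x k * v k <= X2 / (1 - al).
Hypothesis vv_le : forall k, v k ^+ 2 <= Y / al ^+ 2.
Hypothesis sum_xv_le : P <= Y / al.
Hypothesis xx_le : forall k, (1 - al) * x k ^+ 2 <= q k * X2.

Let K := X2 / (1 - al).

Let mu_gt0 : 0 < mu. Proof. by rewrite ltr0n ltnW. Qed.
Let mu_ge2 : 2 <= mu. Proof. by rewrite ler_nat. Qed.
Let al1 : 0 < 1 - al. Proof. by case/andP: al01; rewrite subr_gt0. Qed.
Let al0 : 0 < al. Proof. by case/andP: al01. Qed.
Let X2_ge0 : 0 <= X2. Proof. by apply: sumr_ge0 => k _; rewrite sqr_ge0. Qed.
Let K_ge0 : 0 <= K. Proof. by rewrite divr_ge0 // ltW. Qed.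
Let xx_le_X2 k : x k ^+ 2 <= X2.
Proof. by rewrite /X2 (bigD1 k) //= lerDl sumr_ge0 // => j _; rewrite sqr_ge0. Qed.
Let P_ge0 : 0 <= P. Proof. exact: sumr_ge0. Qed.

Let b_gt0 k : 0 < b k.
Proof. by rewrite invr_gt0 ltr_wpDr // mulr_ge0 // ltW. Qed.
Let bE k : b k + b k * ((mu - 1) * q k) = 1.
Proof. by rewrite -[X in X + _]mulr1 -mulrDr mulVf. Qed.
Let b_le1 k : b k <= 1.
Proof. by rewrite -[leRHS](bE k) lerDl mulr_ge0 ?mulr_ge0 // ltW. Qed.

Let g4_ge0 : 0 <= g4.
Proof.
apply: divr_ge0; last by rewrite mulr_ge0 // ltW.
have [m2|] := eqVneq m 2%N; first by rewrite /mu m2 subrr mul0r.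
rewrite neq_ltn ltnNge m_gt1 /= => m3.
have mu3 : 3 <= mu by rewrite ler_nat.
by rewrite mulr_ge0 // subr_ge0.
Qed.

Let g4_le1 : g4 <= 1.
Proof.
rewrite ler_pdivrMr ?mulr_gt0 // mul1r.
have := mu_ge2; nra.
Qed.

Let g4_le : g4 <= (mu - 1) / mu.
Proof.
rewrite ler_pdivrMr ?mulr_gt0 // mulrA divfK //.
have := mu_ge2; nra.
Qed.

Let g3_ge0 : 0 <= g3.
Proof. by rewrite divr_ge0 ?subr_ge0 ?mulr_ge0 // ltW. Qed.

Let g3_le : g3 <= mu^-1.
Proof.
rewrite ler_pdivrMr ?mulr_gt0 // mulrA mulVf // mul1r; have := mu_ge2; lra.
Qed.

Let g2_ge0 : 0 <= g2.
Proof. by rewrite invr_ge0 mulr_ge0 // ltW. Qed.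

Let g2_le : g2 <= 2 / mu ^+ 2.
Proof.
rewrite -[g2]mul1r ler_pdivrMr ?mulr_gt0 // mulrAC ler_pdivlMr ?exprn_gt0 //.
have := mu_ge2; nra.
Qed.

Let g1_ge0 : 0 <= g1.
Proof. by rewrite invr_ge0 mulr_ge0 ?sqr_ge0 // ltW. Qed.

Let g1_le : g1 <= 4 / mu ^+ 3.
Proof.
rewrite -[g1]mul1r ler_pdivrMr ?mulr_gt0 ?exprn_gt0 // mulrAC ler_pdivlMr ?exprn_gt0 //.
rewrite -subr_ge0 (_ : _ - _ = mu * ((mu - 2) * (3 * mu - 2))); last by ring.
have := mu_ge2 => mu2; rewrite !mulr_ge0 //; lra.
Qed.

(** The 2-norm part of the sampling gives [x k ^+ 2 <= q k * K], and [b k * (mu - 1) * q k <= 1].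
    This is how the diagonal correction gains a factor of order 1/mu. *)
Let bxx_le k : b k * x k ^+ 2 * (mu - 1) <= K.
Proof.
rewrite ler_pdivlMr //.
have bq := ler_wpM2l (mulr_ge0 (ltW (b_gt0 k)) (ltW mu1_gt0)) (xx_le k).
apply: le_trans (_ : b k * ((mu - 1) * q k) * X2 <= _); first by lra.
by rewrite -[leRHS]mul1r ler_wpM2r // -[leRHS](bE k) lerDr ltW.
Qed.

Let g4_term k : g4 * (b k * x k ^+ 2) <= K / mu.
Proof.
have bx0 : 0 <= b k * x k ^+ 2 by rewrite mulr_ge0 ?sqr_ge0 // ltW.
apply: le_trans (ler_wpM2r bx0 g4_le) _.
rewrite mulrAC ler_wpM2r ?invr_ge0 ?(ltW mu_gt0) // mulrC; exact: bxx_le.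
Qed.

Let imu_ge0 : 0 <= mu^-1. Proof. by rewrite invr_ge0 ltW. Qed.

Let cor_le k : `|cor k| <= 3 * (K / mu).
Proof.
have -> : cor k = (2 - 3 * b k) * (g3 * (x k * v k)) + b k * (x k * v k / mu)
   - g4 * (b k * x k ^+ 2).
  (* The factor [q k] hidden in [1 - b k] turns [v k ^+ 2] into [x k * v k], which is bounded by K,
     whereas [v k ^+ 2] alone is bounded only through Y. *)
  have cE : (1 - b k) * g2 * v k ^+ 2 = b k * (x k * v k / mu).
    have -> : 1 - b k = b k * ((mu - 1) * q k) by have := bE k; lra.
    by rewrite -qv /g2; field; rewrite mu_neq0 mu1_neq0.
  by rewrite -cE /cor /h /phi; ring.
have h1 := g4_term k.
have h1' : 0 <= g4 * (b k * x k ^+ 2).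
  by rewrite mulr_ge0 // mulr_ge0 ?sqr_ge0 // ltW.
set z1 := g4 * _ in h1 h1' *.
have h2 : g3 * (x k * v k) <= K / mu.
  by rewrite [leRHS]mulrC ler_pM.
have h2' : 0 <= g3 * (x k * v k) by rewrite mulr_ge0.
set z2 := g3 * _ in h2 h2' *.
have h3 : x k * v k / mu <= K / mu by rewrite ler_wpM2r.
have h3' : 0 <= x k * v k / mu by rewrite mulr_ge0.
set z3 := _ / mu in h3 h3' *.
have := b_gt0 k; have := b_le1 k; set bb := b k; set w := K / mu in h1 h2 h3 *.
move=> bb1 bb0; rewrite ler_norml; apply/andP; split.
  have : 0 <= bb * z3 by rewrite mulr_ge0 // ltW.
  have : 0 <= (1 - bb) * z2 by rewrite mulr_ge0 // subr_ge0.
  nra.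
have : 0 <= bb * z2 by rewrite mulr_ge0 // ltW.
have : 0 <= (1 - bb) * z3 by rewrite mulr_ge0 // subr_ge0.
lra.
Qed.

(** The term with 6 is nonpositive and is dropped. The polynomial [7 * z ^+ 2 - 2 * z - 1] is at
    most 4 on the unit interval, so [g2 <= 2 / mu ^+ 2] produces the 8; the last 4 comes from
    [g1_le]. *)
Let dev_le k : dev k <= 2 * (X2 * K / mu) + 2 / mu ^+ 2 * (K * (Y / al))
  + 8 / mu ^+ 2 * K ^+ 2 + 4 / mu ^+ 3 * (K * (Y / al ^+ 2)).
Proof.
have t1 : g4 * (x k ^+ 4 * b k ^+ 2) <= X2 * K / mu.
  rewrite (_ : _ * _ = b k * x k ^+ 2 * (g4 * (b k * x k ^+ 2))); last by ring.
  have bx0 : 0 <= b k * x k ^+ 2 by rewrite mulr_ge0 ?sqr_ge0 // ltW.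
  rewrite -[leRHS]mulrA; apply: ler_pM => //; first exact: mulr_ge0.
  by apply: le_trans (xx_le_X2 k); rewrite ler_piMl ?sqr_ge0.
have t2 : 0 <= 6 * g3 * (b k * (1 - b k) * (x k ^+ 2 * (x k * v k))).
  apply: mulr_ge0; first by rewrite mulr_ge0.
  apply: mulr_ge0; first by rewrite mulr_ge0 ?subr_ge0 // ltW.
  by rewrite mulr_ge0 ?sqr_ge0.
have t3 : g3 * (x k * v k * X2) <= X2 * K / mu.
  rewrite [leRHS]mulrC [x k * v k * X2]mulrC.
  by apply: ler_pM => //; [exact: mulr_ge0 | exact: ler_wpM2l].
have t4 : g2 * (x k * v k * P) <= 2 / mu ^+ 2 * (K * (Y / al)).
  by apply: ler_pM => //; [exact: mulr_ge0 | exact: ler_pM].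
have t5 : g2 * ((7 * (1 - b k) ^+ 2 - 2 * (1 - b k) - 1) * (x k * v k) ^+ 2) <=
    8 / mu ^+ 2 * K ^+ 2.
  have c4 : 7 * (1 - b k) ^+ 2 - 2 * (1 - b k) - 1 <= 4.
    have := b_gt0 k; have := b_le1 k; nra.
  have sq0 : 0 <= (x k * v k) ^+ 2 by exact: sqr_ge0.
  apply: le_trans (ler_wpM2l g2_ge0 (ler_wpM2r sq0 c4)) _.
  have -> : 8 / mu ^+ 2 * K ^+ 2 = 2 / mu ^+ 2 * (4 * K ^+ 2) by ring.
  apply: ler_pM => //; first by rewrite mulr_ge0.
  by rewrite ler_wpM2l // ler_sqr ?nnegrE.
have t6 : g1 * ((1 - b k) ^+ 2 * (x k * v k * v k ^+ 2)) <=
    4 / mu ^+ 3 * (K * (Y / al ^+ 2)).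
  have xvv0 : 0 <= x k * v k * v k ^+ 2 by rewrite mulr_ge0 ?sqr_ge0.
  apply: ler_pM => //; first by rewrite mulr_ge0 ?sqr_ge0.
  apply: le_trans (_ : x k * v k * v k ^+ 2 <= _); last by rewrite ler_pM ?sqr_ge0.
  rewrite ler_piMl // expr_le1 ?subr_ge0 //.
  by rewrite gerBl ltW.
rewrite /dev mulrDr; lra.
Qed.

Lemma sketch_variance (u : 'rV[R]_d) : Ex (fun t => sqn (u *m (Q t - target))) <=
  Y / (mu * al) * (\sum_k u 0 k * x k) ^+ 2 +
  (8 * X2 ^+ 2 / (mu ^+ 2 * (1 - al) ^+ 2) + 4 * Y * X2 / (mu ^+ 3 * al ^+ 2 * (1 - al))
   + 9 * X2 ^+ 2 / (mu * (1 - al)) + 2 * X2 * Y / (mu ^+ 2 * al * (1 - al))) * sqn u.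
Proof.
rewrite expect_var; set s := \sum_k u 0 k * x k; set U := sqn u.
have U0 : 0 <= U by exact: sqn_ge0.
have main : (g4 * X2 + g3 * P - X2) * s ^+ 2 <= Y / (mu * al) * s ^+ 2.
  rewrite ler_wpM2r ?sqr_ge0 //.
  have h1 : g4 * X2 <= X2 by rewrite ler_piMl.
  have h2 : g3 * P <= Y / (mu * al).
    by rewrite (_ : Y / _ = mu^-1 * (Y / al)) ?ler_pM // invfM; ring.
  lra.
have devs : \sum_k u 0 k ^+ 2 * dev k <= U * (2 * (X2 * K / mu) +
    2 / mu ^+ 2 * (K * (Y / al)) + 8 / mu ^+ 2 * K ^+ 2 + 4 / mu ^+ 3 * (K * (Y / al ^+ 2))).
  rewrite /U sqn_sum mulr_suml; apply: ler_sum => k _.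
  by rewrite ler_wpM2l ?sqr_ge0.
have cs : (\sum_k `|u 0 k| * `|x k|) ^+ 2 <= U * X2.
  rewrite /U sqn_sum; apply: le_trans (cauchy_schwarz_sum _ _) _.
  rewrite le_eqVlt; apply/orP; left; apply/eqP.
  by congr (_ * _); apply: eq_bigr => k _; rewrite real_normK ?num_real.
have cross : 2 * s * (\sum_k u 0 k * x k * cor k) <= 6 * (K / mu) * (U * X2).
  set T := \sum_k `|u 0 k| * `|x k|.
  have T0 : 0 <= T by apply: sumr_ge0 => k _; rewrite mulr_ge0.
  have sT : `|s| <= T.
    by apply: le_trans (ler_norm_sum _ _ _) _; apply: ler_sum => k _; rewrite normrM.
  have cT : `|\sum_k u 0 k * x k * cor k| <= T * (3 * (K / mu)).
    apply: le_trans (ler_norm_sum _ _ _) _; rewrite mulr_suml; apply: ler_sum => k _.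
    by rewrite !normrM ler_wpM2l ?mulr_ge0.
  have w0 : 0 <= K / mu by rewrite mulr_ge0.
  apply: le_trans (ler_norm _) _; rewrite !normrM ger0_norm // -mulrA.
  apply: le_trans (ler_wpM2l _ (ler_pM _ _ sT cT)) _ => //.
  by have := ler_wpM2l w0 cs; rewrite -/T; lra.
apply: le_trans (lerD (lerD main cross) devs) _.
rewrite -addrA lerD2l -subr_ge0.
(* Of the nine copies of [X2 * K / mu], two pay for [dev] and six for the cross term; this one is
   left over. *)
rewrite (_ : _ - _ = U * (X2 * K / mu)); last first.
  rewrite /K; field; rewrite mu_neq0 !gt_eqF //.
by apply: mulr_ge0 => //; apply: mulr_ge0 => //; exact: mulr_ge0.
Qed.

End Variance.

(** * Operator norms *)

Section OperatorNorm.
Variables (R : realType) (d : nat).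
Implicit Types (Z M : 'M[R]_d).

Lemma sqn_mul_sym Z (u : 'rV[R]_d) : Z^T = Z ->
  sqn (u *m Z) = \sum_i eigval Z i ^+ 2 * (u *m (eigvec Z)^T) 0 i ^+ 2.
Proof.
move=> Zsym; rewrite (sqn_eigbasis _ Zsym); apply: eq_bigr => i _.
rewrite -exprMn; congr (_ ^+ 2).
rewrite -{1}(spectral_fun_id Zsym) /spectral_fun !mulmxA.
rewrite -(mulmxA _ (eigvec Z)) eigvecK // mulmx1.
by rewrite mul_mx_diag !mxE mulrC.
Qed.

(** At a unit eigenvector the quadratic form is the eigenvalue, so for symmetric Z the numerical
    radius controls the norm. *)
Lemma sqn_mul_le_qform Z r : Z^T = Z ->
  (forall u : 'rV[R]_d, `|qform Z u| <= r * sqn u) ->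
  forall u : 'rV[R]_d, sqn (u *m Z) <= r ^+ 2 * sqn u.
Proof.
move=> Zsym Zr u; rewrite sqn_mul_sym // (sqn_eigbasis u Zsym) mulr_sumr.
apply: ler_sum => i _; rewrite ler_wpM2r ?sqr_ge0 //.
have := Zr (row i (eigvec Z)); rewrite sqn_eigvec // mulr1 -eigval_qform // => h.
rewrite -[leLHS]real_normK ?num_real // ler_sqr ?nnegrE //.
exact: le_trans h.
Qed.

Lemma vnorm_sqr (v : 'cV[R]_d) : vnorm v ^+ 2 = sqn v^T.
Proof.
rewrite /vnorm sqr_sqrtr; last by apply: sumr_ge0 => k _; rewrite sqr_ge0.
by rewrite sqn_sum; apply: eq_bigr => k _; rewrite mxE.
Qed.

Lemma vnorm_ge0 (v : 'cV[R]_d) : 0 <= vnorm v.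
Proof. exact: sqrtr_ge0. Qed.

Lemma sqn_mulmx_le M (u : 'rV[R]_d) :
  sqn (u *m M) <= sqn u * \sum_j \sum_k M k j ^+ 2.
Proof.
rewrite [sqn (u *m M)]sqn_sum mulr_sumr; apply: ler_sum => j _.
by rewrite mxE sqn_sum; exact: cauchy_schwarz_sum.
Qed.

Lemma vnorm_le_specnorm M (v : 'cV[R]_d) : vnorm v = 1 -> vnorm (M *m v) <= specnorm M.
Proof.
move=> v1; apply: ub_le_sup; last by exists v.
(* The Frobenius norm bounds the set whose supremum is [specnorm]. *)
exists (Num.sqrt (\sum_j \sum_k M^T k j ^+ 2)) => _ [w [w1 ->]].
rewrite -ler_sqr ?nnegrE ?vnorm_ge0 ?sqrtr_ge0 // vnorm_sqr sqr_sqrtr; last first.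
  by apply: sumr_ge0 => j _; apply: sumr_ge0 => k _; rewrite sqr_ge0.
rewrite trmx_mul; apply: le_trans (sqn_mulmx_le _ _) _.
by rewrite -vnorm_sqr w1 expr1n mul1r.
Qed.

Lemma qform_le_vnorm M (v : 'cV[R]_d) : vnorm v = 1 -> qform M v^T <= vnorm (M *m v).
Proof.
move=> v1; apply: le_trans (ler_norm _) _.
rewrite -ler_sqr ?nnegrE ?vnorm_ge0 // real_normK ?num_real //.
rewrite vnorm_sqr -[leRHS]mul1r -(expr1n _ 2) -v1 vnorm_sqr !sqn_sum.
apply: le_trans (cauchy_schwarz_sum _ _); rewrite le_eqVlt; apply/orP; left; apply/eqP.
rewrite /qform -mulmxA trmxK mxE; congr (_ ^+ 2).
by apply: eq_bigr => k _; congr (_ * _); rewrite [RHS]mxE.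
Qed.

Lemma qform_le_specnorm M (u : 'rV[R]_d) : qform M u <= specnorm M * sqn u.
Proof.
have [/eqP|u0] := eqVneq (sqn u) 0.
  rewrite /sqn dot_self_eq0 => /eqP ->.
  by rewrite /qform /sqn !mul0mx mxE mulr0.
have sq0 : 0 < sqn u by rewrite lt_neqAle eq_sym u0 sqn_ge0.
pose c := (Num.sqrt (sqn u))^-1; pose v : 'cV[R]_d := c *: u^T.
have cc : c ^+ 2 * sqn u = 1 by rewrite /c exprVn sqr_sqrtr ?sqn_ge0 // mulVf.
have c2 : 0 < c ^+ 2 by rewrite exprn_gt0 // invr_gt0 sqrtr_gt0.
have qc N : qform N v^T = c ^+ 2 * qform N u.
  have -> : v^T = c *: u by rewrite /v linearZ /= trmxK.
  by rewrite /qform linearZ /= -scalemxAr -!scalemxAl scalerA mxE expr2.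
have v1 : vnorm v = 1.
  rewrite -[LHS](ger0_norm (vnorm_ge0 _)) -sqrtr_sqr vnorm_sqr -qform1 qc qform1 cc.
  by rewrite sqrtr1.
rewrite -(ler_pM2l c2) mulrCA cc mulr1 -qc.
exact: le_trans (qform_le_vnorm _ v1) (vnorm_le_specnorm _ v1).
Qed.

(** Turns a large norm into one large eigenvalue, hence into a one-sided event for M or for its
    negative. Positive dimension makes the set under the supremum nonempty. *)
Lemma specnorm_gt_eigval M x : (0 < d)%N -> M^T = M -> 0 <= x -> x < specnorm M ->
  exists i, x < `|eigval M i|.
Proof.
move=> d0 Msym x0 xM.
have [v [v1 xv]] : exists v : 'cV[R]_d, vnorm v = 1 /\ x < vnorm (M *m v).
  have [//|/forallNP h] := pselect (exists v : 'cV[R]_d, vnorm v = 1 /\ x < vnorm (M *m v)).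
  exfalso; move: xM; rewrite ltNge => /negP; apply.
  apply: sup_le_ub.
    pose v : 'cV[R]_d := delta_mx (Ordinal d0) 0.
    exists (vnorm (M *m v)), v; split => //.
    rewrite /vnorm (bigD1 (Ordinal d0)) //= big1 => [|k /negbTE k0].
      by rewrite mxE !eqxx expr1n addr0 sqrtr1.
    by rewrite mxE k0 expr0n.
  move=> _ [v [v1 ->]]; rewrite leNgt; apply/negP => xv.
  by apply: (h v).
apply/existsP; apply: contraTT xv => /existsPn h; rewrite -leNgt.
rewrite -ler_sqr ?nnegrE ?vnorm_ge0 // vnorm_sqr trmx_mul Msym sqn_mul_sym //.
rewrite -[leRHS]mulr1 -(expr1n _ 2) -v1 vnorm_sqr (sqn_eigbasis _ Msym) mulr_sumr.
apply: ler_sum => i _; rewrite ler_wpM2r ?sqr_ge0 //.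
rewrite -[leLHS]real_normK ?num_real // ler_sqr ?nnegrE //.
by rewrite leNgt h.
Qed.

End OperatorNorm.

(** * The norm of one summand *)

(** The tangent line at 0 is too crude at -1/2, where it would give only 2. It is used at -1/32
    instead and raised to the 16th power, which exceeds 3/5. *)
Lemma expR_half_le (R : realType) : expR (2^-1 : R) <= 5 / 3.
Proof.
have h : 31 / 32 <= expR (- 32^-1 : R).
  by apply: le_trans (expR_ge1Dx _); lra.
have e : expR (2^-1 : R) * expR (- 32^-1) ^+ 16 = 1.
  rewrite -expRM_natl -expRD (_ : _ + _ = 0) ?expR0 //; lra.
have h16 : (31 / 32) ^+ 16 <= expR (- 32^-1 : R) ^+ 16.
  by rewrite lerXn2r ?nnegrE ?expR_ge0 //; lra.
have c : 3 / 5 <= (31 / 32) ^+ 16 :> R by lra.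
have p0 : 0 < expR (- 32^-1 : R) ^+ 16 by rewrite exprn_gt0 ?expR_gt0.
rewrite -(ler_pM2r p0) e; lra.
Qed.

(** * Chernoff bound for a sample count *)

Section CountTail.
Variables (R : realType) (I T : finType) (p : I -> T -> R).
Hypothesis p_ge0 : forall i k, 0 <= p i k.
Hypothesis p_sum1 : forall i, \sum_k p i k = 1.
Variables (m : nat) (e : 'I_m -> I) (q : T -> R).
Hypothesis e_inj : injective e.
Hypothesis p_e : forall j k, p (e j) k = q k.
Hypothesis q_ge0 : forall k, 0 <= q k.

(** Chernoff with parameter 1/2: as [expR 2^-1 - 1 <= 2/3], the mean of [expR (N / 2)] is at most
    [expr] of two thirds of the mean count, written [expR (2 / 3 * (m%:R * q k))]. Doubling the
    exponent gives 4/3 and [2 * L]. *)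
Lemma count_tail k (L : R) :
  \sum_(t | ~~ ((count_upto e m t k)%:R <= 4 / 3 * (m%:R * q k) + 2 * L)) prodwt p t
  <= expR (- L).
Proof.
apply: le_trans (_ : expect p (fun t => expR (- (2 / 3 * (m%:R * q k) + L)) *
    expR 2^-1 ^+ count_upto e m t k) <= _).
  apply: markov => // t; first by rewrite mulr_ge0 ?exprn_ge0 ?expR_ge0.
  rewrite -ltNge -expRM_natl -expRD => h; rewrite -[leLHS]expR0 ler_expR; lra.
rewrite expectZ (expect_pow_count p_sum1 e_inj p_e) // opprD expRD mulrAC.
rewrite ler_piMl ?expR_ge0 // expRN mulrC ler_pdivrMr ?expR_gt0 // mul1r.
have q1 : 0 <= q k * (expR 2^-1 - 1).
  by rewrite mulr_ge0 // subr_ge0 -[leLHS]expR0 ler_expR invr_ge0.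
rewrite (_ : 2 / 3 * (m%:R * q k) = m%:R * (2 / 3 * q k)); last by ring.
rewrite expRM_natl lerXn2r ?nnegrE ?expR_ge0 ?addr_ge0 //.
apply: le_trans (expR_ge1Dx _); rewrite lerD2l mulrC ler_wpM2r //.
have := expR_half_le R; lra.
Qed.

End CountTail.

(** * Norm of a sketch whose counts are controlled *)

Section SketchNorm.
Variables (R : realType) (I : finType) (d m : nat) (e : 'I_m -> I).
Variables (q x v : 'I_d -> R) (al Y L : R) (t : {ffun I -> 'I_d}).
Hypothesis m_gt1 : (1 < m)%N.
Hypothesis q_ge0 : forall k, 0 <= q k.
Hypothesis qv : forall k, q k * v k = x k.
Hypothesis al0 : 0 < al.
Hypothesis Y0 : 0 <= Y.
Hypothesis L0 : 0 <= L.
Hypothesis vv_le : forall k, v k ^+ 2 <= Y / al ^+ 2.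
Hypothesis count_le : forall k, Ncount R e t k <= 4 / 3 * (m%:R * q k) + 2 * L.

Let mu : R := m%:R.
Let N := Ncount R e t.
Let y k := v k * N k / mu.
Let X2 := \sum_k x k ^+ 2.
Let y2 := \sum_k y k ^+ 2.
Let M := Y / (mu * al ^+ 2).

Let mu_gt0 : 0 < mu. Proof. by rewrite ltr0n ltnW. Qed.

Lemma sum_count : \sum_k N k = mu.
Proof.
rewrite /N /Ncount -natr_sum; congr (_%:R).
under eq_bigr do rewrite ffunE.
rewrite exchange_big /= (eq_bigl xpredT) => [|j]; last exact: ltn_ord.
rewrite -[RHS]card_ord -sum1_card; apply: eq_bigr => j _.
by rewrite (bigD1 (t (e j))) //= eqxx big1 // => k; rewrite eq_sym => /negbTE ->.
Qed.

(** Only one of the two count factors in [y k ^+ 2] is replaced by its tail bound. The part with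
    [x k] is absorbed by Young's inequality; the part with L stays linear in the counts, which sum
    to mu exactly. Hence L enters only linearly and the sum over k costs nothing. *)
Lemma sketch_vec_norm : y2 <= 16 / 9 * X2 + 4 * (L * M).
Proof.
have Nge0 k : 0 <= N k by exact: ler0n.
have term k : y k ^+ 2 <= 2^-1 * y k ^+ 2 + 8 / 9 * x k ^+ 2 + 2 * L * (M / mu) * N k.
  pose z := `|v k| * N k / mu.
  have z0 : 0 <= z by rewrite /z divr_ge0 ?mulr_ge0 // ltW.
  have zy : y k ^+ 2 = z ^+ 2.
    by rewrite /z /y !exprMn real_normK ?num_real.
  have zz : z ^+ 2 <= z * (`|v k| * (4 / 3 * (mu * q k) + 2 * L) / mu).
    rewrite expr2 ler_wpM2l // /z ler_wpM2r ?invr_ge0 ?(ltW mu_gt0) //.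
    by rewrite ler_wpM2l.
  have zE : `|v k| * (4 / 3 * (mu * q k) + 2 * L) / mu =
      4 / 3 * `|x k| + 2 * L * `|v k| / mu.
    by rewrite -qv normrM (ger0_norm (q_ge0 k)); field; rewrite gt_eqF.
  rewrite zE in zz.
  apply: le_trans (_ : 2^-1 * z ^+ 2 + 8 / 9 * x k ^+ 2 + 2 * L * (`|v k| * z / mu) <= _).
    have := sqr_ge0 (z - 4 / 3 * `|x k|).
    rewrite -[x k ^+ 2]real_normK ?num_real //; lra.
  rewrite zy lerD2l -[leRHS]mulrA ler_wpM2l ?mulr_ge0 //.
  have -> : `|v k| * z / mu = v k ^+ 2 * (N k / mu ^+ 2).
    by rewrite /z -[v k ^+ 2]real_normK ?num_real //; field; rewrite gt_eqF.
  have -> : M / mu * N k = Y / al ^+ 2 * (N k / mu ^+ 2).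
    by rewrite /M; field; rewrite !gt_eqF.
  by rewrite ler_wpM2r // divr_ge0 ?sqr_ge0.
have : y2 <= \sum_k (2^-1 * y k ^+ 2 + 8 / 9 * x k ^+ 2 + 2 * L * (M / mu) * N k).
  exact: ler_sum.
rewrite !big_split /= -!mulr_sumr sum_count -/y2 -/X2.
have -> : 2 * L * (M / mu) * mu = 2 * (L * M) by field; rewrite gt_eqF.
lra.
Qed.

(** Up to the factor [mu / (mu - 1)], which is at most 2, the sketch is a difference of two
    nonnegative forms, each at most [y2 * sqn u]; the difference is therefore bounded by one copy of
    [y2], not two. *)
Lemma sketch_qform_le (u : 'rV[R]_d) :
  `|qform (sketch e q v t - target x) u| <= (2 * y2 + X2) * sqn u.
Proof.
have X20 : 0 <= X2 by apply: sumr_ge0 => k _; rewrite sqr_ge0.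
have y20 : 0 <= y2 by apply: sumr_ge0 => k _; rewrite sqr_ge0.
have u0 : 0 <= sqn u by exact: sqn_ge0.
pose sx := \sum_k u 0 k * x k; pose sy := \sum_k u 0 k * y k.
pose b := shrink m q.
pose D := \sum_k u 0 k ^+ 2 * y k ^+ 2 * b k.
have qD : qform (target x) u = sx ^+ 2.
  rewrite qformE expr2 /sx mulr_suml; apply: eq_bigr => k _.
  by rewrite mulr_sumr; apply: eq_bigr => l _; rewrite mxE; ring.
have qQ : qform (sketch e q v t) u = mu / (mu - 1) * (sy ^+ 2 - D).
  rewrite qformE expr2 /sy mulr_suml /D -sumrB mulr_sumr; apply: eq_bigr => k _.
  have -> : u 0 k ^+ 2 * y k ^+ 2 * b k =
     \sum_l (if l == k then u 0 k * u 0 l * (y k * y l) * b k else 0).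
    by rewrite -big_mkcond big_pred1_eq; ring.
  rewrite mulr_sumr -sumrB mulr_sumr; apply: eq_bigr => l _; rewrite mxE eq_sym.
  rewrite -!/(N _) -!/(y _) -/b -/mu.
  by case: eqP => _ /=; ring.
have b01 k : 0 <= b k <= 1.
  have h : 1 <= 1 + (mu - 1) * q k.
    by rewrite lerDl mulr_ge0 // subr_ge0 (ler_nat _ 1) ltnW.
  rewrite invr_ge0 (le_trans _ h) //= invf_le1 //; exact: lt_le_trans h.
have D0 : 0 <= D.
  apply: sumr_ge0 => k _; rewrite mulr_ge0 //; last by case/andP: (b01 k).
  by rewrite mulr_ge0 ?sqr_ge0.
have Dle : D <= sqn u * y2.
  rewrite sqn_sum mulr_suml; apply: ler_sum => k _; rewrite -mulrA.
  rewrite ler_wpM2l ?sqr_ge0 //; case/andP: (b01 k) => b0 b1.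
  apply: le_trans (_ : y k ^+ 2 <= _); first by rewrite ler_piMr ?sqr_ge0.
  by rewrite /y2 (bigD1 k) //= lerDl sumr_ge0 // => l _; rewrite sqr_ge0.
have sxle : sx ^+ 2 <= sqn u * X2 by rewrite sqn_sum cauchy_schwarz_sum.
have syle : sy ^+ 2 <= sqn u * y2 by rewrite sqn_sum cauchy_schwarz_sum.
have beta : 0 <= mu / (mu - 1) <= 2.
  have mu2 : 2 <= mu by rewrite ler_nat.
  have mu1 : 0 < mu - 1 by lra.
  rewrite divr_ge0 ?(ltW mu_gt0) ?(ltW mu1) // ler_pdivrMr //; lra.
rewrite qformB qD qQ; move: beta; set bt := mu / (mu - 1) => /andP[bt0 bt2].
have h0 : `|sy ^+ 2 - D| <= sqn u * y2.
  by rewrite ler_norml; have := sqr_ge0 sy; lra.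
have h1 : `|bt * (sy ^+ 2 - D)| <= 2 * (sqn u * y2).
  by rewrite normrM ger0_norm // ler_pM.
apply: le_trans (ler_normB _ _) _; rewrite [`|sx ^+ 2|]ger0_norm ?sqr_ge0 //; lra.
Qed.

End SketchNorm.

(** * The DACE estimator *)

Section Dace.
Variables (R : realType) (d n m : nat) (X : 'M[R]_(d, n)) (alpha eta delta : R).
Hypothesis n_gt0 : (0 < n)%N.
Hypothesis X_neq0 : forall i : 'I_n, col i X != 0.
Hypothesis m_gt1 : (2 <= m)%N.
Hypothesis m_lt_d : (m < d)%N.
Hypothesis alpha01 : 0 < alpha < 1.
Hypothesis eta01 : 0 < eta < 1.
Hypothesis delta01 : 0 < delta < 1.

Notation Omega := {ffun 'I_n * 'I_m -> 'I_d}.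
Let P (ij : 'I_n * 'I_m) k := pki X alpha k ij.1.
Let e (i : 'I_n) (j : 'I_m) := (i, j).
Let q i k := pki X alpha k i.
Let x i k := X k i.
Let v i k := X k i / pki X alpha k i.
Let mu : R := m%:R.
Let al0 : 0 < alpha. Proof. by case/andP: alpha01. Qed.
Let al1 : 0 < 1 - alpha. Proof. by case/andP: alpha01; rewrite subr_gt0. Qed.
Let d_gt2 : (2 < d)%N. Proof. exact: leq_ltn_trans m_lt_d. Qed.
Let nR : 0 < n%:R :> R. Proof. by rewrite ltr0n. Qed.
Let muR : 0 < mu. Proof. by rewrite ltr0n ltnW. Qed.
Let mu1R : 0 < mu - 1. Proof. by rewrite subr_gt0 ltr1n. Qed.

Let l2_gt0 i : 0 < l2sq X i.
Proof.
have -> : l2sq X i = sqn (col i X)^T.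
  by rewrite sqn_sum; apply: eq_bigr => k _; rewrite !mxE.
rewrite lt_neqAle sqn_ge0 andbT eq_sym /sqn dot_self_eq0.
by apply: contraNneq (X_neq0 i) => h; rewrite -[col i X]trmxK h trmx0.
Qed.

Let l1_gt0 i : 0 < l1n X i.
Proof.
rewrite lt_neqAle sumr_ge0 // andbT eq_sym; apply/negP => /eqP h.
have := l2_gt0 i; rewrite /l2sq big1 ?ltxx // => k _.
have := psumr_eq0P (fun k _ => normr_ge0 (X k i)) h (i := k) isT.
by move/eqP; rewrite normr_eq0 => /eqP ->; rewrite expr0n.
Qed.

Let q_l1 i k : alpha * `|X k i| <= q i k * l1n X i.
Proof.
rewrite /q /pki [leRHS]mulrDl divfK ?gt_eqF // lerDl mulr_ge0 ?(ltW (l1_gt0 i)) //.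
by rewrite divr_ge0 ?(ltW (l2_gt0 i)) // mulr_ge0 ?sqr_ge0 // ltW.
Qed.

Let q_l2 i k : (1 - alpha) * X k i ^+ 2 <= q i k * l2sq X i.
Proof.
rewrite /q /pki [leRHS]mulrDl divfK ?gt_eqF // lerDr mulr_ge0 ?(ltW (l2_gt0 i)) //.
by rewrite divr_ge0 ?(ltW (l1_gt0 i)) // mulr_ge0 // ltW.
Qed.

Let q_ge0 i k : 0 <= q i k.
Proof.
rewrite -(pmulr_lge0 _ (l2_gt0 i)); apply: le_trans (q_l2 i k).
by rewrite mulr_ge0 ?sqr_ge0 // ltW.
Qed.

Let P_ge0 ij k : 0 <= P ij k. Proof. exact: q_ge0. Qed.

Let P_sum1 ij : \sum_k P ij k = 1.
Proof.
rewrite /P /pki big_split /= -!mulr_suml -!mulr_sumr.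
rewrite -/(l1n X _) -/(l2sq X _) !mulfK ?gt_eqF //; ring.
Qed.

Let x0_of_q0 i k : q i k = 0 -> X k i = 0.
Proof.
move=> q0; have := q_l1 i k; rewrite q0 mul0r pmulr_rle0 // normr_le0.
by move/eqP.
Qed.

(** Where [q i k] is zero, the default inverse makes [v i k] zero; the relation survives because the
    entry of X vanishes there too. *)
Let qv i k : q i k * v i k = x i k.
Proof.
rewrite /v; have [q0|q0] := eqVneq (q i k) 0.
  by rewrite q0 mul0r /x x0_of_q0.
by rewrite mulrC divfK.
Qed.

Let v_le i k : `|v i k| <= l1n X i / alpha.
Proof.
have [q0|q0] := eqVneq (q i k) 0.
  by rewrite /v x0_of_q0 // mul0r normr0 divr_ge0 // ltW.
have qpos : 0 < q i k by rewrite lt_neqAle eq_sym q0 q_ge0.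
rewrite /v normrM normfV (ger0_norm (q_ge0 i k)) ler_pdivrMr //.
by rewrite mulrAC ler_pdivlMr // mulrC [leRHS]mulrC q_l1.
Qed.

Let vv_le i k : v i k ^+ 2 <= l1n X i ^+ 2 / alpha ^+ 2.
Proof.
rewrite -exprVn -exprMn -[leLHS]real_normK ?num_real // lerXn2r ?nnegrE //.
by rewrite divr_ge0 ?ltW.
Qed.

Let xv_ge0 i k : 0 <= x i k * v i k.
Proof. by rewrite -qv -mulrA -expr2 mulr_ge0 ?sqr_ge0. Qed.

Let xv_le i k : x i k * v i k <= l2sq X i / (1 - alpha).
Proof.
have [q0|q0] := eqVneq (q i k) 0.
  by rewrite /x x0_of_q0 // mul0r divr_ge0 ?ltW.
have qpos : 0 < q i k by rewrite lt_neqAle eq_sym q0 q_ge0.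
rewrite /v mulrA ler_pdivrMr // mulrAC ler_pdivlMr // -expr2.
by rewrite mulrC [leRHS]mulrC q_l2.
Qed.

Let sum_xv_le i : \sum_k x i k * v i k <= l1n X i ^+ 2 / alpha.
Proof.
rewrite expr2 -mulrA {1}/l1n mulr_suml; apply: ler_sum => k _.
apply: le_trans (ler_norm _) _; rewrite normrM.
by rewrite ler_wpM2l.
Qed.

Let e_inj i : injective (e i). Proof. by move=> j j' []. Qed.
Let P_e i j k : P (e i j) k = q i k. Proof. by []. Qed.

Let Z i (t : Omega) : 'M[R]_d := n%:R^-1 *: (sketch (e i) (q i) (v i) t - target (x i)).

Let smatE t i : Smat X alpha t i *m (Smat X alpha t i)^T =
  diag_mx (\row_k (Ncount R (e i) t k / (mu * q i k))).
Proof.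
apply/matrixP => k l; rewrite !mxE.
have [<-|kl] := eqVneq k l.
  rewrite mulr1n /Ncount ffunE natr_sum mulr_suml [RHS]big_mkcond /=.
  apply: eq_bigr => j _; rewrite !mxE ltn_ord /e.
  case: eqP => [tk|_]; last by rewrite !mul0r.
  rewrite mul1r -expr2 exprVn sqr_sqrtr // mulr_ge0 ?(ltW muR) //.
  exact: q_ge0.
rewrite mulr0n big1 // => j _; rewrite !mxE.
by case: eqP => [->|_]; rewrite ?mul0r // (negbTE kl) mulr0.
Qed.

Let SxxSE t i k l : SxxS X alpha t i k l =
  v i k * Ncount R (e i) t k / mu * (v i l * Ncount R (e i) t l / mu).
Proof.
have -> : SxxS X alpha t i = diag_mx (\row_k (Ncount R (e i) t k / (mu * q i k))) *m
    (col i X *m (col i X)^T) *m diag_mx (\row_k (Ncount R (e i) t k / (mu * q i k))).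
  by rewrite /SxxS -smatE !mulmxA.
rewrite mul_mx_diag mul_diag_mx !mxE big_ord1 !mxE.
by rewrite /v -/(q i k) -/(q i l) !invfM; ring.
Qed.

Let sum_Z t : Ce X alpha t - Cmat X = \sum_i Z i t.
Proof.
rewrite /Ce /C1hat /C2hat /Cmat /Z -scaler_sumr sumrB scalerBr.
have fac : Cfac R n m = n%:R^-1 * (mu / (mu - 1)).
  rewrite /Cfac -/mu; field; rewrite !gt_eqF //.
  by rewrite (_ : _ - _ = n%:R * (mu - 1)) ?mulr_gt0 //; ring.
congr (_ - _); last first.
  congr (_ *: _); apply/matrixP => k l; rewrite mxE summxE.
  by apply: eq_bigr => i _; rewrite !mxE.
rewrite -scalerBr -sumrB fac -scalerA scaler_sumr; congr (_ *: _).
apply: eq_bigr => i _; apply/matrixP => k l.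
have mxB (A B : 'M[R]_d) : (A - B) k l = A k l - B k l by rewrite mxE [X in _ + X]mxE.
rewrite [LHS]mxE mxB SxxSE.
have -> : (Ddiag (SxxS X alpha t i) *m Dvec (fun k0 => bki m X alpha k0 i)) k l =
    (k == l)%:R * (SxxS X alpha t i k l * bki m X alpha k i).
  rewrite mxE (bigD1 k) //= big1 => [|j /negbTE jk].
    rewrite !mxE eqxx addr0; case: eqP => [<-|_] /=; ring.
  by rewrite !mxE eq_sym jk mul0r.
rewrite SxxSE [sketch _ _ _ _ _ _]mxE -/mu.
rewrite (_ : shrink m (q i) k = bki m X alpha k i) //; ring.
Qed.

Lemma count_resample_in i (S : {set 'I_n * 'I_m}) (t t' : Omega) :
  (forall j, e i j \in S) ->
  count_upto (e i) m (resample S t t') = count_upto (e i) m t'.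
Proof.
move=> h; apply/ffunP => k; rewrite !ffunE; apply: eq_bigr => j _.
by rewrite ffunE h.
Qed.

Lemma count_resample_out i (S : {set 'I_n * 'I_m}) (t t' : Omega) :
  (forall j, e i j \notin S) ->
  count_upto (e i) m (resample S t t') = count_upto (e i) m t.
Proof.
move=> h; apply/ffunP => k; rewrite !ffunE; apply: eq_bigr => j _.
by rewrite ffunE (negbTE (h j)).
Qed.

Let block i : {set 'I_n * 'I_m} := [set ij | ij.1 == i].
Let L := ln (2 * n%:R * d%:R / eta).
Let Ev i (t : Omega) := [forall k, Ncount R (e i) t k <= 4 / 3 * (mu * q i k) + 2 * L].

Let Z_eq i (t t' : Omega) : count_upto (e i) m t = count_upto (e i) m t' -> Z i t = Z i t'.
Proof.
move=> h; rewrite /Z; congr (_ *: (_ - _)).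
by apply/matrixP => k l; rewrite !mxE /Ncount h.
Qed.

Let Ev_eq i (t t' : Omega) : count_upto (e i) m t = count_upto (e i) m t' -> Ev i t = Ev i t'.
Proof. by move=> h; apply: eq_forallb => k; rewrite /Ncount h. Qed.

(** Allows the linear L of the norm estimate to be replaced by the square in [Rbound]. The argument
    of the logarithm is at least 6, while e is at most 25/9. *)
Let L_ge1 : 1 <= L.
Proof.
have /andP[eta0 eta1] := eta01.
have big : 6 <= 2 * n%:R * d%:R / eta.
  rewrite ler_pdivlMr //.
  have n1 : 1 <= n%:R :> R by rewrite ler1n.
  have d3 : 3 <= d%:R :> R by rewrite ler_nat.
  have : 3 <= n%:R * d%:R :> R by nra.
  nra.
rewrite -ler_expR lnK ?posrE; last by apply: lt_le_trans big.
apply: le_trans big.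
have -> : 1 = 2%:R * 2^-1 :> R by rewrite divff ?pnatr_eq0.
rewrite expRM_natl.
have := expR_half_le R; have := expR_ge0 (2^-1 : R); nra.
Qed.

Let Rb := Rbound m X alpha eta.

Let Rb_ge i : 7 * l2sq X i / n%:R
     + L ^+ 2 * (14 * l1n X i ^+ 2) / (n%:R * mu * alpha ^+ 2) <= Rb.
Proof. exact: le_bigmax. Qed.

Let Rb_gt0 : 0 < Rb.
Proof.
apply: lt_le_trans (Rb_ge (Ordinal n_gt0)).
rewrite ltr_wpDr //.
  apply: divr_ge0; apply: mulr_ge0; rewrite ?sqr_ge0 //.
    by rewrite mulr_ge0 ?sqr_ge0.
  by rewrite mulr_ge0 // ltW.
by rewrite divr_gt0 // mulr_gt0.
Qed.

Let r := 2 * Rb / 3.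

Let Zsym i t : (Z i t)^T = Z i t.
Proof.
rewrite /Z linearZ /= linearB /=; congr (_ *: (_ - _)); apply/matrixP => k l; rewrite !mxE.
  by rewrite eq_sym; have [->|_] := eqVneq k l; rewrite ?mul0r //; ring.
by rewrite mulrC.
Qed.

Let Z_bounded i t (u : 'rV[R]_d) : Ev i t -> sqn (u *m Z i t) <= r ^+ 2 * sqn u.
Proof.
move=> /forallP Evt; apply: sqn_mul_le_qform => // {}u.
have L0 : 0 <= L by apply: le_trans L_ge1.
have Y0 : 0 <= l1n X i ^+ 2 by exact: sqr_ge0.
rewrite /Z qformZ normrM ger0_norm ?invr_ge0 ?(ltW nR) //.
have qf := @sketch_qform_le _ _ d m (e i) (q i) (x i) (v i) t m_gt1 (q_ge0 i) u.
have yn := @sketch_vec_norm _ _ d m (e i) (q i) (x i) (v i) alpha _ L t m_gt1 (q_ge0 i)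
  (qv i) al0 L0 (vv_le i) Evt.
have ni0 : 0 <= n%:R^-1 :> R by rewrite invr_ge0 ltW.
apply: le_trans (ler_wpM2l ni0 qf) _.
rewrite mulrA ler_wpM2r ?sqn_ge0 //.
apply: le_trans (_ : 2 / 3 * (7 * l2sq X i / n%:R
     + L ^+ 2 * (14 * l1n X i ^+ 2) / (n%:R * mu * alpha ^+ 2)) <= _); last first.
  by have := Rb_ge i; rewrite /r; lra.
rewrite -/(l2sq X i) -/mu in yn *.
(* The estimates combine to weights [2 * 16/9 + 1 = 41/9] and [8 * L], compared here with 14/3 and
   [28/3 * L ^+ 2]. *)
have -> : 2 / 3 * (7 * l2sq X i / n%:R
     + L ^+ 2 * (14 * l1n X i ^+ 2) / (n%:R * mu * alpha ^+ 2)) =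
   n%:R^-1 * (14 / 3 * l2sq X i + 28 / 3 * (L ^+ 2 * (l1n X i ^+ 2 / (mu * alpha ^+ 2)))).
  by field; rewrite !gt_eqF.
rewrite ler_wpM2l //.
set M := l1n X i ^+ 2 / _ in yn *.
have M0 : 0 <= M by rewrite divr_ge0 ?mulr_ge0 ?sqr_ge0 // ltW.
have LM : L * M <= L ^+ 2 * M by rewrite ler_wpM2r // expr2 ler_peMl.
have LM0 : 0 <= L * M by rewrite mulr_ge0.
have := l2_gt0 i; lra.
Qed.

Let qform_target i (u : 'rV[R]_d) : qform (target (x i)) u = (\sum_k u 0 k * x i k) ^+ 2.
Proof.
rewrite qformE expr2 mulr_suml; apply: eq_bigr => k _.
by rewrite mulr_sumr; apply: eq_bigr => l _; rewrite mxE; ring.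
Qed.

Let Z_mean0 i (u : 'rV[R]_d) : expect P (fun t => qform (Z i t) u) = 0.
Proof.
transitivity (n%:R^-1 * (expect P (fun t => qform (sketch (e i) (q i) (v i) t) u) -
    qform (target (x i)) u)).
  rewrite -[qform (target _) u](expect_cst P_sum1) -expectB -expectZ.
  by apply: eq_expect => t; rewrite qformZ qformB.
rewrite (_ : expect _ _ = qform (target (x i)) u) ?subrr ?mulr0 //.
transitivity (expect P (fun t => \sum_k \sum_l u 0 k * u 0 l *
    sketch (e i) (q i) (v i) t k l)).
  apply: eq_expect => t; rewrite qformE; apply: eq_bigr => k _.
  by apply: eq_bigr => l _; rewrite mulrAC.
rewrite expect_sum qformE; apply: eq_bigr => k _.
rewrite expect_sum; apply: eq_bigr => l _; rewrite expectZ.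
rewrite (expect_sketch P_sum1 (@e_inj i) (@P_e i) m_gt1 d_gt2 (qv i) (q_ge0 i)).
by rewrite mxE; ring.
Qed.

Let S i : R := 8 * l2sq X i ^+ 2 / (mu ^+ 2 * (1 - alpha) ^+ 2)
   + 4 * l1n X i ^+ 2 * l2sq X i / (mu ^+ 3 * alpha ^+ 2 * (1 - alpha))
   + 9 * l2sq X i ^+ 2 / (mu * (1 - alpha))
   + 2 * l2sq X i * l1n X i ^+ 2 / (mu ^+ 2 * alpha * (1 - alpha)).

(** The rank-one part stays a matrix because [sigma2] takes the spectral norm of its sum over i, not
    the sum of the norms; the rest is scalar. *)
Let V i : 'M[R]_d :=
  n%:R^-1 ^+ 2 *: ((l1n X i ^+ 2 / (mu * alpha)) *: target (x i) + S i *: 1%:M).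

Let Vsym i : (V i)^T = V i.
Proof.
rewrite trmxZ_sym // trmxD_sym // trmxZ_sym ?trmx1 //.
by apply/matrixP => k l; rewrite !mxE mulrC.
Qed.

Let Z_var i (u : 'rV[R]_d) : expect P (fun t => sqn (u *m Z i t)) <= qform (V i) u.
Proof.
rewrite (_ : expect _ _ = n%:R^-1 ^+ 2 *
   expect P (fun t => sqn (u *m (sketch (e i) (q i) (v i) t - target (x i))))); last first.
  rewrite -expectZ; apply: eq_expect => t.
  by rewrite /Z -scalemxAr /sqn linearZ /= -scalemxAr -scalemxAl scalerA mxE expr2.
rewrite /V qformZ qformD !qformZ qform1 qform_target ler_wpM2l ?sqr_ge0 //.
exact (sketch_variance P_sum1 (@e_inj i) (@P_e i) m_gt1 d_gt2 (qv i) (q_ge0 i)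
  alpha01 (xv_ge0 i) (xv_le i) (vv_le i) (sum_xv_le i) (q_l2 i) u).
Qed.

Let s2 := sigma2 m X alpha.

Let sum_V_le (u : 'rV[R]_d) : qform (\sum_i V i) u <= s2 * sqn u.
Proof.
pose W : 'M[R]_d := \sum_(i < n)
  ((l1n X i ^+ 2 / (n%:R ^+ 2 * m%:R * alpha)) *: (col i X *m (col i X)^T)).
have -> : qform (\sum_i V i) u = (\sum_i n%:R^-1 ^+ 2 * S i) * sqn u + qform W u.
  rewrite !qform_sum mulr_suml -big_split; apply: eq_bigr => i _ /=.
  have -> : col i X *m (col i X)^T = target (x i).
    by apply/matrixP => k l; rewrite !mxE big_ord1 !mxE.
  rewrite /V !(qformZ, qformD) qform1 -/mu.
  by field; rewrite !gt_eqF.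
apply: le_trans (lerD (lexx _) (qform_le_specnorm W u)) _.
rewrite -mulrDl ler_wpM2r ?sqn_ge0 // /s2 /sigma2 -/W lerD2r.
apply: ler_sum => i _; rewrite le_eqVlt; apply/orP; left; apply/eqP.
by rewrite /S -/mu; field; rewrite !gt_eqF.
Qed.

(** Obtained by evaluating [sum_V_le] at a unit vector, where every [V i] has a positive quadratic
    form. *)
Let s2_gt0 : 0 < s2.
Proof.
have u1 : exists u : 'rV[R]_d, sqn u = 1.
  exists (delta_mx 0 (Ordinal (ltn_trans (isT : (0 < 2)%N) d_gt2))).
  rewrite sqn_sum (bigD1 (Ordinal (ltn_trans (isT : (0 < 2)%N) d_gt2))) //= big1.
    by rewrite mxE !eqxx expr1n addr0.
  by move=> k /negbTE k0; rewrite mxE k0 andbF expr0n.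
case: u1 => u u1; have := sum_V_le u; rewrite u1 mulr1; apply: lt_le_trans.
have S0 i : 0 < S i.
  have ia := al1; have l2 := l2_gt0 i; have l1 := l1_gt0 i.
  by rewrite /S; repeat apply: addr_gt0; apply: divr_gt0;
    repeat first [apply: mulr_gt0 | apply: exprn_gt0].
have V0 i : 0 < qform (V i) u.
  rewrite /V !(qformZ, qformD) qform1 u1 mulr1 qform_target.
  rewrite mulr_gt0 ?exprn_gt0 ?invr_gt0 // ltr_wpDl //.
  by rewrite mulr_ge0 ?sqr_ge0 // divr_ge0 ?sqr_ge0 // mulr_ge0 // ltW.
rewrite qform_sum (bigD1 (Ordinal n_gt0)) //= ltr_pwDl // sumr_ge0 // => i _.
exact: ltW.
Qed.

Let L' := ln (2 * d%:R / delta).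

Let dR : 0 < d%:R :> R. Proof. by rewrite ltr0n (ltn_trans _ d_gt2). Qed.

Let L'_gt0 : 0 < L'.
Proof.
have /andP[delta0 delta1] := delta01.
rewrite ln_gt0 // ltr_pdivlMr // mul1r; apply: lt_trans delta1 _.
have : 3 <= d%:R :> R by rewrite ler_nat.
lra.
Qed.

Let r_gt0 : 0 < r. Proof. by rewrite divr_gt0 // mulr_gt0. Qed.

Let bound := L' * r + Num.sqrt (2 * s2 * L').
Let allEv (t : Omega) := [forall i, Ev i t].

Let block_in i j : e i j \in block i. Proof. by rewrite inE. Qed.
Let block_out i i' j : i' != i -> e i' j \notin block i. Proof. by rewrite inE. Qed.

(** Every hypothesis of [matrix_bernstein] is invariant under a change of sign of the summands, so
    both tails share one proof. The choice of [L'] makes [d%:R * expR (- L')] equal to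
    [delta / 2]. *)
Let tail (W : 'I_n -> Omega -> 'M[R]_d) : W = Z \/ W = (fun i t => - Z i t) ->
  \sum_(t | allEv t && `[< exists u : 'rV[R]_d, sqn u = 1 /\
      bound <= qform (\sum_i W i t) u >]) prodwt P t <= delta / 2.
Proof.
have /andP[delta0 _] := delta01.
move=> WE.
have -> : delta / 2 = d%:R * expR (- L').
  rewrite expRN lnK ?posrE ?divr_gt0 ?mulr_gt0 //.
  by field; rewrite !gt_eqF.
apply: (@matrix_bernstein _ _ _ P P_ge0 P_sum1 n d block W Ev V r) s2_gt0 L'_gt0 sum_V_le _.
- by move=> i t; case: WE => ->; rewrite ?linearN /= Zsym.
- exact: Vsym.
- move=> i t t'; have h := count_resample_in t t' (block_in i).
  by case: WE => ->; rewrite (Z_eq h).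
- by move=> i t t'; apply: Ev_eq; exact: count_resample_in.
- move=> i i' t t' ii'.
  have h := count_resample_out t t' (fun j => block_out j ii').
  by case: WE => ->; rewrite (Z_eq h).
- move=> i i' t t' ii'; apply: Ev_eq; apply: count_resample_out => j.
  exact: block_out.
- move=> i u; case: WE => ->; first exact: Z_mean0.
  transitivity (- expect P (fun t => qform (Z i t) u)); last by rewrite Z_mean0 oppr0.
  rewrite -mulN1r -expectZ; apply: eq_expect => t.
  by rewrite -scaleN1r qformZ.
- move=> i u; case: WE => ->; first exact: Z_var.
  apply: le_trans (Z_var i u); rewrite le_eqVlt; apply/orP; left; apply/eqP.
  apply: eq_expect => t; rewrite mulmxN /sqn linearN /= mulNmx mulmxN opprK //.
- move=> i t u Evt; case: WE => ->; first exact: Z_bounded.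
  by rewrite mulmxN /sqn linearN /= mulNmx mulmxN opprK; exact: Z_bounded.
- exact: r_gt0.
- by move=> t /andP[/forallP Evt /asboolP h].
Qed.

(** Union bound over the n d counts, each failing with probability at most [expR (- L)], that is eta
    divided by 2 n d. *)
Let not_allEv : \sum_(t | ~~ allEv t) prodwt P t <= eta / 2.
Proof.
have /andP[eta0 _] := eta01.
pose A (ik : 'I_n * 'I_d) (t : Omega) :=
  ~~ (Ncount R (e ik.1) t ik.2 <= 4 / 3 * (mu * q ik.1 ik.2) + 2 * L).
apply: le_trans (prob_exists P_ge0 (A := A) _) _.
  by move=> t /forallPn[i /forallPn[k h]]; exists (i, k).
apply: le_trans (_ : \sum_(ik : 'I_n * 'I_d) expR (- L) <= _).
  apply: ler_sum => -[i k] _.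
  exact: (count_tail P_ge0 P_sum1 (@e_inj i) (@P_e i) (q_ge0 i)).
rewrite sumr_const card_prod !card_ord expRN lnK; last first.
  by rewrite posrE divr_gt0 // !mulr_gt0.
rewrite le_eqVlt; apply/orP; left; apply/eqP; rewrite -[LHS]mulr_natl natrM.
by field; rewrite !gt_eqF.
Qed.

Lemma dace_error_bound :
  1 - eta - delta <= \sum_(t : outcome d n m | specnorm (Ce X alpha t - Cmat X) <=
     ln (2 * d%:R / delta) * (2 * Rbound m X alpha eta / 3)
     + Num.sqrt (2 * sigma2 m X alpha * ln (2 * d%:R / delta))) weight X alpha t.
Proof.
have /andP[eta0 _] := eta01.
pose good (t : Omega) := specnorm (Ce X alpha t - Cmat X) <= bound.
rewrite -/Rb -/s2 -/L' -/r -/bound -/(good _).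
have tot : \sum_(t | good t) prodwt P t + \sum_(t | ~~ good t) prodwt P t = 1.
  by rewrite -(prodwt_sum1 P_sum1) [RHS](bigID good).
(* Three ways to fail: some count is too large, or all counts are fine and the top eigenvalue of the
   sum or of its negative reaches the bound. Together they cost at most [eta / 2 + delta]. *)
pose A (j : 'I_3) (t : Omega) : bool := match val j with
  | 0%N => ~~ allEv t
  | 1%N => allEv t && `[< exists u : 'rV[R]_d, sqn u = 1 /\
              bound <= qform (\sum_i Z i t) u >]
  | _ => allEv t && `[< exists u : 'rV[R]_d, sqn u = 1 /\
              bound <= qform (\sum_i - Z i t) u >] end.
have bad : \sum_(t | ~~ good t) prodwt P t <= \sum_j \sum_(t | A j t) prodwt P t.
  apply: prob_exists => // t; rewrite -ltNge sum_Z => h.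
  have [Evt|] := boolP (allEv t); last by exists (@Ordinal 3 0 isT).
  have Msym : (\sum_i Z i t)^T = \sum_i Z i t.
    by rewrite linear_sum /=; apply: eq_bigr => i _.
  have b0 : 0 <= bound by rewrite addr_ge0 ?sqrtr_ge0 // mulr_ge0 // ltW.
  have [j] := specnorm_gt_eigval (ltn_trans (isT : (0 < 2)%N) d_gt2) Msym b0 h.
  rewrite lter_normr => /orP[hi|hi].
    exists (@Ordinal 3 1 isT); rewrite /A /= Evt; apply/asboolP.
    exists (row j (eigvec (\sum_i Z i t))); rewrite sqn_eigvec // -eigval_qform //.
    by rewrite ltW.
  exists (@Ordinal 3 2 isT); rewrite /A /= Evt; apply/asboolP.
  exists (row j (eigvec (\sum_i Z i t))); rewrite sqn_eigvec // sumrN.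
  by rewrite -scaleN1r qformZ mulN1r -eigval_qform // ltW.
rewrite !big_ord_recl big_ord0 addr0 in bad.
have t1 := tail (or_introl erefl); have t2 := tail (or_intror erefl).
have := le_trans bad (lerD not_allEv (lerD t1 t2)).
have -> : \sum_(t | good t) weight X alpha t = \sum_(t | good t) prodwt P t by [].
lra.
Qed.

End Dace.

Theorem theorem2 (R : realType) (d n m : nat) (X : 'M[R]_(d, n)) (alpha eta delta : R) :
  (0 < n)%N ->
  (forall i : 'I_n, col i X != 0) ->
  (2 <= m)%N -> (m < d)%N ->
  0 < alpha < 1 ->
  0 < eta < 1 -> 0 < delta < 1 ->
  \sum_(t : outcome d n m |
          specnorm (Ce X alpha t - Cmat X)
          <= ln (2 * d%:R / delta) * (2 * Rbound m X alpha eta / 3)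
             + Num.sqrt (2 * sigma2 m X alpha * ln (2 * d%:R / delta)))
     weight X alpha t
  >= 1 - eta - delta.
Proof.
exact: dace_error_bound.
Qed.
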